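(* For each parameter $p \in \{\dim_2,\operatorname{cw},\operatorname{iir}\}$ there is a polynomial-time algorithm, which for a poset $P$ decides if $p(P) = |P|$.
   Context: All posets are finite with non-empty ground sets. An inclusion representation of a poset $P$ is a family $\mathcal{S}=\{S_x:x\in P\}$ of sets with $x\le y$ in $P$ iff $S_x\subseteq S_y$; $\bigcup\mathcal{S}$ is its ground set. The cube height $\operatorname{ch}(P)$ is the least $h$ such that $P$ has an inclusion representation with $|S_x|\le h$ for all $x$. The cube width $\operatorname{cw}(P)$ is the least $w$ such that $P$ has an inclusion representation $\mathcal{S}$ with $|\bigcup\mathcal{S}|=w$ and $|S_x|\le\operatorname{ch}(P)$ for all $x$. The 2-dimension $\dim_2(P)$ is the least $w$ such that $P$ has an inclusion representation $\mathcal{S}$ with $|\bigcup\mathcal{S}|=w$. For inclusion representations $\mathcal{S},\mathcal{S}'$ of $P$, $\mathcal{S}$ is a reduction of $\mathcal{S}'$ if $|\bigcup\mathcal{S}|\le|\bigcup\mathcal{S}'|$ and $|S_x|\le|S'_x|$ for all $x$; equivalent if each is a reduction of the other; a strict reduction if a reduction but not equivalent; irreducible if it has no strict reduction. $\operatorname{iir}(P)$ is the maximum size of the ground set of an irreducible inclusion representation of $P$. *)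

(* Defs.v *)
From mathcomp Require Import all_boot all_order finmap.
From mathcomp.classical Require Import boolp.

Set Implicit Arguments.
Unset Strict Implicit.
Unset Printing Implicit Defensive.

Import Order.Theory.

Section WellDefinedExtrema.

Variable A : nat -> Prop.

Lemma asbool_ex (exA : exists n, A n) : exists n, `[< A n >].
Proof. by have [n /asboolP ?] := exA; exists n. Qed.

Lemma asbool_bounded b (bA : forall n, A n -> n <= b) n : `[< A n >] -> n <= b.
Proof. by move/asboolP/bA. Qed.

Definition least_nat (exA : exists n, A n) : nat := ex_minn (asbool_ex exA).

Definition greatest_nat b (exA : exists n, A n)
    (bA : forall n, A n -> n <= b) : nat :=
  ex_maxn (asbool_ex exA) (asbool_bounded bA).

Lemma least_natP exA :
  A (least_nat exA) /\ forall n, A n -> least_nat exA <= n.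
Proof.
rewrite /least_nat; case: ex_minnP => m /asboolP Am mP.
by split=> // n /asboolP; apply: mP.
Qed.

Lemma greatest_natP b exA bA :
  A (@greatest_nat b exA bA) /\ forall n, A n -> n <= @greatest_nat b exA bA.
Proof.
rewrite /greatest_nat; case: ex_maxnP => m /asboolP Am mP.
by split=> // n /asboolP; apply: mP.
Qed.

End WellDefinedExtrema.

Section InclusionRepresentations.

Variables (d : Order.disp_t) (P : finPOrderType d).

(* Only cardinalities matter, so the members of the family are taken, up to
   renaming of the elements, to be finite sets of naturals. Infinite sets are
   irrelevant: a representation with a finite ground set always exists, and it
   is a strict reduction of any representation with an infinite one. *)
Implicit Types S : P -> {fset nat}.

Definition inclusion_rep S : Prop :=
  forall x y : P, (x <= y)%O = (S x `<=` S y)%fset.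

Definition ground S : {fset nat} := (\bigcup_(x in P) S x)%fset.

Definition reduction S S' : Prop :=
  #|` ground S| <= #|` ground S'| /\ forall x, #|` S x| <= #|` S' x|.

Definition equivalent_rep S S' : Prop := reduction S S' /\ reduction S' S.

Definition strict_reduction S S' : Prop :=
  reduction S S' /\ ~ equivalent_rep S S'.

Definition irreducible S : Prop :=
  inclusion_rep S /\
  ~ exists S', inclusion_rep S' /\ strict_reduction S' S.

Definition has_rep_of_height (h : nat) : Prop :=
  exists S, inclusion_rep S /\ forall x, #|` S x| <= h.

Definition has_rep_of_ground_size (w : nat) : Prop :=
  exists S, inclusion_rep S /\ #|` ground S| = w.

Definition has_irreducible_of_ground_size (w : nat) : Prop :=
  exists S, irreducible S /\ #|` ground S| = w.

Lemma mem_ground S a : reflect (exists x, a \in S x) (a \in ground S).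
Proof.
apply: (iffP (bigfcupP _ _ _ _)) => [[x _ ax]|[x ax]]; first by exists x.
by exists x; rewrite ?mem_index_enum.
Qed.

Lemma sub_ground S x : (S x `<=` ground S)%fset.
Proof. by apply/fsubsetP => a ax; apply/mem_ground; exists x. Qed.

Lemma inclusion_rep_exists : exists S, inclusion_rep S.
Proof.
pose S (x : P) := [fset (enum_rank y : nat) | y in P & (y <= x)%O]%fset.
have memS x y : ((enum_rank y : nat) \in S x) = (y <= x)%O.
  apply/imfsetP/idP => [[z /= + /ord_inj/enum_rank_inj ->]|yx].
    by rewrite inE.
  by exists y; rewrite ?inE.
exists S => x y; apply/idP/fsubsetP => [xy a|sxy].
  move=> /[dup] /imfsetP[z _ ->]; rewrite !memS => zx; exact: le_trans zx xy.
by rewrite -memS sxy // memS.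
Qed.

Lemma height_exists : exists h, has_rep_of_height h.
Proof.
have [S SP] := inclusion_rep_exists.
by exists #|` ground S|, S; split=> // x; apply/fsubset_leq_card/sub_ground.
Qed.

Definition ch : nat := least_nat height_exists.

Definition has_ch_rep_of_ground_size (w : nat) : Prop :=
  exists S,
    [/\ inclusion_rep S, #|` ground S| = w & forall x, #|` S x| <= ch].

Lemma ch_rep_exists : exists w, has_ch_rep_of_ground_size w.
Proof.
have [[S [SP Sch]] _] := least_natP height_exists.
by exists #|` ground S|, S.
Qed.

Lemma ground_size_exists : exists w, has_rep_of_ground_size w.
Proof.
by have [S SP] := inclusion_rep_exists; exists #|` ground S|, S.
Qed.

Lemma irreducible_exists : exists w, has_irreducible_of_ground_size w.
Proof.
pose m S := #|` ground S| + \sum_(x : P) #|` S x|.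
have [S0] := inclusion_rep_exists.
have [n] := ubnP (m S0); elim: n S0 => // n IHn S0 /ltnSE mS0 S0P.
have [[S [SP [[gS hS] neq]]]|no] :=
    pselect (exists S', inclusion_rep S' /\ strict_reduction S' S0); last first.
  by exists #|` ground S0|, S0.
apply: (IHn S) => //; apply: leq_trans mS0; rewrite ltnNge; apply/negP => le.
have leS : \sum_(x : P) #|` S x| <= \sum_(x : P) #|` S0 x| by apply: leq_sum.
apply: neq; split=> //; split.
  by rewrite -(leq_add2r (\sum_x #|` S0 x|)) (leq_trans le) ?leq_add2l.
have eqS : \sum_(x : P) #|` S x| = \sum_(x : P) #|` S0 x|.
  apply/eqP; rewrite eqn_leq leS -(leq_add2l #|` ground S0|) (leq_trans le) //.
  by rewrite leq_add2r.
move=> x; move: eqS; rewrite (bigD1 x) //= [RHS](bigD1 x) //= => eqS.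
rewrite -(leq_add2r (\sum_(y | y != x) #|` S0 y|)) -eqS leq_add2l.
exact: leq_sum.
Qed.

(* If the ground set is too large, then two of its elements belong to the same
   sets, and deleting one of them gives a strict reduction. *)
Lemma irreducible_bounded w : has_irreducible_of_ground_size w -> w <= 2 ^ #|P|.
Proof.
case=> S [[SP irr] <-]; rewrite leqNgt; apply/negP => big.
pose f (a : ground S) := [set x : P | val a \in S x].
have /injectivePn[a [b ab fab]] : ~~ injectiveb f.
  apply/negP => /injectiveP /leq_card.
  rewrite -[X in _ <= X]cardsT -(@powersetT P) card_powerset.
  by rewrite cardsT -cardfE leqNgt big.
have eqab x : (val a \in S x) = (val b \in S x).
  by move/setP/(_ x): fab; rewrite !inE.
pose S' x := (S x `\ val a)%fset.
have gS' : (ground S' `<` ground S)%fset.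
  rewrite fproperE; apply/andP; split.
    apply/fsubsetP=> c /mem_ground[x].
    by rewrite !inE => /andP[_ cx]; apply/mem_ground; exists x.
  apply/fsubsetPn; exists (val a); first exact: valP.
  by apply/mem_ground => -[x]; rewrite !inE eqxx.
apply: irr; exists S'; split=> [x y|].
  rewrite SP; apply/fsubsetP/fsubsetP => sub c.
    by rewrite !inE => /andP[-> /sub].
  have [-> |ca cx] := eqVneq c (val a).
    rewrite !eqab => bx.
    have /sub : val b \in S' x by rewrite !inE bx andbT val_eqE eq_sym ab.
    by rewrite !inE => /andP[].
  by have := sub c; rewrite !inE ca cx => /(_ isT).
split; first split.
- exact/fsubset_leq_card/fproper_sub.
- by move=> x; apply/fsubset_leq_card/fsubsetP => c; rewrite !inE => /andP[].
by case=> _ [+ _]; rewrite leqNgt fproper_ltn_card.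
Qed.

Definition cw : nat := least_nat ch_rep_exists.

Definition dim2 : nat := least_nat ground_size_exists.

Definition iir : nat := greatest_nat irreducible_exists irreducible_bounded.

End InclusionRepresentations.

(* The computation model is the random access machine of Cook and Reckhow, with
   unit cost per instruction: it has addition and (truncated) subtraction but no
   multiplication, so unit-cost polynomial time is Turing polynomial time. The
   registers hold naturals and the input is a read-only word with random
   access. *)
Inductive instr : Type :=
| IConst of nat & nat         (* IConst i c : R_i := c *)
| IAdd of nat & nat & nat     (* IAdd i j k : R_i := R_j + R_k *)
| ISub of nat & nat & nat     (* ISub i j k : R_i := R_j - R_k *)
| ILoad of nat & nat          (* ILoad i j  : R_i := R_(R_j) *)
| IStore of nat & nat         (* IStore i j : R_(R_i) := R_j *)
| IInput of nat & nat         (* IInput i j : R_i := w_(R_j), 0 past the end *)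
| IJumpPos of nat & nat.      (* IJumpPos i l : if R_i > 0 goto l *)

Definition program := seq instr.

Record config := Config { pc : nat; regs : nat -> nat }.

Definition set_reg (r : nat -> nat) (i v : nat) : nat -> nat :=
  fun j => if j == i then v else r j.

Definition exec (w : seq nat) (c : config) (op : instr) : config :=
  let: Config l r := c in
  match op with
  | IConst i v => Config l.+1 (set_reg r i v)
  | IAdd i j k => Config l.+1 (set_reg r i (r j + r k))
  | ISub i j k => Config l.+1 (set_reg r i (r j - r k))
  | ILoad i j => Config l.+1 (set_reg r i (r (r j)))
  | IStore i j => Config l.+1 (set_reg r (r i) (r j))
  | IInput i j => Config l.+1 (set_reg r i (nth 0 w (r j)))
  | IJumpPos i k => Config (if 0 < r i then k else l.+1) r
  end.

Definition halted (M : program) (c : config) : bool := size M <= pc c.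

(* A halted configuration is a fixed point of the step function. *)
Definition step (M : program) (w : seq nat) (c : config) : config :=
  if onth M (pc c) is Some op then exec w c op else c.

Definition run (M : program) (w : seq nat) (t : nat) : config :=
  iter t (step M w) (Config 0 (fun=> 0)).

(* Within t steps, M halts on w with the answer b in R_0. *)
Definition answers_within (M : program) (w : seq nat) (t : nat) (b : bool) :
    Prop :=
  halted M (run M w t) /\ regs (run M w t) 0 = b.

(* The input word is n = |P| followed by the n * n bits of the order relation,
   row by row, for a labelling e of the elements of P. *)
Definition poset_word d (P : finPOrderType d) (e : 'I_#|P| -> P) : seq nat :=
  #|P| :: [seq nat_of_bool (e i <= e j)%O | i <- enum 'I_#|P|,
                                            j <- enum 'I_#|P|].

Definition poset_property :=
  forall (d : Order.disp_t) (P : finPOrderType d), bool.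

Definition polytime_decidable (A : poset_property) : Prop :=
  exists (M : program) (c k : nat),
    forall (d : Order.disp_t) (P : finPOrderType d) (e : 'I_#|P| -> P),
      0 < #|P| -> bijective e ->
      answers_within M (poset_word e) (c * #|P| ^ k) (A d P).

(* Main.v *)
Require Import Defs.
From mathcomp Require Import all_boot all_order finmap zify.
From mathcomp.classical Require Import boolp.

(* An element of the ground set can be identified with the up-set of the x whose
   set contains it; a representation is then a family of up-sets separating x
   from y whenever x is not below y, and the principal up-sets give one with |P|
   members. An exchange argument shows that every representation can be reduced
   to one with fewer than |P| members, unless each of its sets is at least as
   large as in the principal one. Hence, for dim_2, cw and iir respectively, the
   equality with |P| says that no family with fewer than |P| members has sets of
   size at most |P|, max |down x|, or |down x| at every x.

   For iir it is enough that no principal up-set can be dropped and no two of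
   them can be merged. For dim_2 the condition is that every connected component
   of the incomparability graph is a star (a chain plus an isolated element), a
   triangle, K4, or K4 minus an edge; for cw the component of the maximal elements
   may moreover be an antichain of any size at least 2. Components are stacked on
   top of each other, which allows an induction removing the topmost one.

   All three conditions are first-order statements about the order, and a fixed
   first-order sentence is evaluated by nested loops. *)

Set Implicit Arguments.
Unset Strict Implicit.
Unset Printing Implicit Defensive.

Import Order.Theory.

(** * First-order properties on the random access machine *)

(** The sizes of the components come from small Boolean lattices. Four tokens (members of the ground
    set) have six two-element subsets, so five pairwise incomparable elements can be coded by pairs
    with one token saved. Three tokens admit no antichain of four sets; their antichains of three
    are full levels, and a set incomparable to two members of a full level is the third. Coding by
    pairs needs room for two tokens beyond those of the lower components. Under the bound of cw a
    topmost antichain has room for only one, and this is the sole difference between dim_2 and cw. A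
    component with another one above it never feels the bound, because each principal down-set above
    contains all of it and all that lies beneath. During the induction the bound cannot be tied to
    the poset: deleting an element whose strict down-set is principal lowers the bound by one. Hence
    the bound is a free parameter, only required to dominate the principal down-sets. *)

Inductive formula :=
| FLe of nat & nat
| FNot of formula
| FAnd of formula & formula
| FAll of formula.

Definition extend (T : Type) (env : nat -> T) (v : nat) (x : T) : nat -> T :=
  fun u => if u == v then x else env u.

Section Semantics.

Variables (T : finType) (le : rel T).

(* Variables are de Bruijn levels: under [v] quantifiers, [FAll] binds [v]. *)
Fixpoint sat (v : nat) (f : formula) (env : nat -> T) : bool :=
  match f with
  | FLe i j => le (env i) (env j)
  | FNot f1 => ~~ sat v f1 env
  | FAnd f1 f2 => sat v f1 env && sat v f2 env
  | FAll f1 => [forall x, sat v.+1 f1 (extend env v x)]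
  end.

End Semantics.

Fixpoint closed_at (v : nat) (f : formula) : bool :=
  match f with
  | FLe i j => (i < v) && (j < v)
  | FNot f1 => closed_at v f1
  | FAnd f1 f2 => closed_at v f1 && closed_at v f2
  | FAll f1 => closed_at v.+1 f1
  end.

(* R_0 holds the result, R_1 = 1, R_2 = n, R_3 is scratch; if variable v has
   index i, then R_(4+2v) = i and R_(5+2v) = i * n, since there is no
   multiplication. *)
Definition index_reg v := 4 + v.*2.
Definition row_reg v := 5 + v.*2.

Fixpoint compile (v p : nat) (f : formula) : program :=
  match f with
  | FLe i j =>
      [:: IAdd 3 (row_reg i) (index_reg j); IAdd 3 3 1; IInput 0 3]
  | FNot f1 => compile v p f1 ++ [:: ISub 0 1 0]
  | FAnd f1 f2 =>
      let c1 := compile v p f1 in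
      let q := p + size c1 + 2 in
      let c2 := compile v q f2 in
      c1 ++ [:: IJumpPos 0 q; IJumpPos 1 (q + size c2)] ++ c2
  | FAll f1 =>
      let c := compile v.+1 (p + 2) f1 in
      let q := p + 2 + size c in
      [:: IConst (index_reg v) 0; IConst (row_reg v) 0] ++ c ++
      [:: IJumpPos 0 (q + 2); IJumpPos 1 (q + 6);
          IAdd (index_reg v) (index_reg v) 1; IAdd (row_reg v) (row_reg v) 2;
          ISub 3 2 (index_reg v); IJumpPos 3 (p + 2)]
  end.

Fixpoint quantifier_depth (f : formula) : nat :=
  match f with
  | FLe _ _ => 0
  | FNot f1 => quantifier_depth f1
  | FAnd f1 f2 => maxn (quantifier_depth f1) (quantifier_depth f2)
  | FAll f1 => (quantifier_depth f1).+1
  end.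

(** The 8 of a quantifier pays for two initialisations and for the instructions after the body in
    each pass, bounded by 6. These constants are multiplied by [n ^ quantifier_depth f] in the
    running time. *)
Fixpoint formula_cost (f : formula) : nat :=
  match f with
  | FLe _ _ => 3
  | FNot f1 => formula_cost f1 + 1
  | FAnd f1 f2 => formula_cost f1 + formula_cost f2 + 2
  | FAll f1 => formula_cost f1 + 8
  end.

Definition code_at (M : program) (p : nat) (c : program) : Prop :=
  forall i, i < size c -> onth M (p + i) = onth c i.

Lemma code_at_cat M p c1 c2 :
  code_at M p (c1 ++ c2) -> code_at M p c1 /\ code_at M (p + size c1) c2.
Proof.
move=> Mc; split=> i ic.
  by rewrite Mc ?size_cat ?ltn_addr // onth_cat ic.
by rewrite -addnA Mc ?size_cat ?ltn_add2l // onth_cat ltnNge leq_addr addKn.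
Qed.

(** * Correctness and running time of the compiled program *)

Section CompileCorrect.

Variables (n : nat) (M : program) (w : seq nat) (le : rel 'I_n).
Hypothesis n_gt0 : 0 < n.
Hypothesis wE : forall i j : 'I_n, nth 0 w (i * n + j + 1) = le i j.

Definition reaches (t : nat) (a b : config) : Prop := iter t (step M w) a = b.

Lemma reaches_trans t1 t2 a b c :
  reaches t1 a b -> reaches t2 b c -> reaches (t1 + t2) a c.
Proof. by rewrite /reaches addnC iterD => -> ->. Qed.

Lemma reaches_at t a p q r :
  reaches t a (Config p r) -> p = q -> reaches t a (Config q r).
Proof. by move=> ? <-. Qed.

Lemma reaches_step p op i c r :
  code_at M p c -> onth c i = Some op ->
  reaches 1 (Config (p + i) r) (exec w (Config (p + i) r) op).
Proof.
move=> Mc ci; rewrite /reaches /= /step /= Mc ?ci //.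
by rewrite ltnNge; apply/negP => le_i; rewrite onth_default in ci.
Qed.

Record represents (v : nat) (env : nat -> 'I_n) (r : nat -> nat) : Prop :=
  Represents {
    one_reg : r 1 = 1;
    size_reg : r 2 = n;
    env_reg : forall u, u < v ->
      r (index_reg u) = env u /\ r (row_reg u) = env u * n }.

(** Registers 0 and 3 are result and scratch; those from [4 + v.*2] on belong to variables not yet
    bound and may be overwritten. *)
Definition preserves (v : nat) (r r' : nat -> nat) : Prop :=
  forall i, i < 4 + v.*2 -> i != 0 -> i != 3 -> r' i = r i.

Lemma preserves_trans v r r' r'' :
  preserves v r r' -> preserves v r' r'' -> preserves v r r''.
Proof. by move=> e e' i iv i0 i3; rewrite e' ?e. Qed.

Lemma preservesS v r r' : preserves v.+1 r r' -> preserves v r r'.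
Proof. by move=> e i iv; apply: e; lia. Qed.

Lemma preserves_set v r i x :
  (i == 0) || (i == 3) || (4 + v.*2 <= i) -> preserves v r (set_reg r i x).
Proof. by move=> hi j jv j0 j3; rewrite /set_reg; case: eqP => // ?; lia. Qed.

Lemma represents_preserved v env r r' :
  preserves v r r' -> represents v env r -> represents v env r'.
Proof.
move=> rr' [r1 r2 re]; split=> [||u uv]; [by rewrite rr'|by rewrite rr'|].
have [e1 e2] := re u uv; rewrite /index_reg /row_reg in e1 e2 *.
by rewrite !rr' ?e1 ?e2 //; lia.
Qed.

Definition computes (v p : nat) (c : program) (b : (nat -> 'I_n) -> bool) T :=
  forall env r, represents v env r ->
  exists t r', [/\ t <= T, reaches t (Config p r) (Config (p + size c) r'),
    r' 0 = b env & preserves v r r'].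

(** The loop is entered at an arbitrary index so that induction on [n - i] applies; the result then
    concerns only the values from [i] on. The first failing value ends the loop with R_0 = 0. *)
Lemma compile_loop v p c b K env r (i : 'I_n) :
    let q := p + size c in
    computes v.+1 p c b K ->
    code_at M q
      [:: IJumpPos 0 (q + 2); IJumpPos 1 (q + 6);
          IAdd (index_reg v) (index_reg v) 1; IAdd (row_reg v) (row_reg v) 2;
          ISub 3 2 (index_reg v); IJumpPos 3 p] ->
    represents v env r -> r (index_reg v) = i -> r (row_reg v) = i * n ->
  exists t r', [/\ t <= (n - i) * (K + 6),
    reaches t (Config p r) (Config (q + 6) r'),
    r' 0 = [forall x : 'I_n, (i <= x) ==> b (extend env v x)]
    & preserves v r r'].
Proof.
move=> q cb Mq; have [m] := ubnP (n - i).
elim: m i r => // m IHm i r nim rep ri rr.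
have rep1 : represents v.+1 (extend env v i) r.
  have [r1 r2 re] := rep; split=> // u; rewrite ltnS /extend leq_eqVlt.
  by case: eqP => [->|_] //= uv; apply: re.
have [t [r1 [tT rt r10 rr1]]] := cb _ _ rep1.
have one1 : r1 1 = 1 by rewrite rr1 ?(one_reg rep).
have n1 : r1 2 = n by rewrite rr1 ?(size_reg rep) //; lia.
have ix1 : r1 (index_reg v) = i by rewrite rr1 // /index_reg; lia.
have row1 : r1 (row_reg v) = i * n by rewrite rr1 // /row_reg; lia.
have jump := reaches_step r1 Mq (i := 0) erefl.
rewrite /= addn0 r10 in jump.
have [bi|bi] := boolP (b (extend env v i)); last first.
  rewrite (negbTE bi) /= in jump.
  (* Since R_1 = 1, this jump is unconditional. *)
  have jump' := reaches_step r1 Mq (i := 1) erefl.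
  rewrite /= one1 addn1 in jump'.
  exists (t + 1 + 1), r1; split.
  - have := ltn_ord i; nia.
  - exact: reaches_trans (reaches_trans rt jump) jump'.
  - rewrite r10 (negbTE bi); case: forallP => // /(_ i).
    by rewrite leqnn (negbTE bi).
  - exact: preservesS.
rewrite bi /= in jump.
pose r2 := set_reg r1 (index_reg v) i.+1.
pose r3 := set_reg r2 (row_reg v) (i.+1 * n).
pose r4 := set_reg r3 3 (n - i.+1).
have s2 := reaches_step r1 Mq (i := 2) erefl.
rewrite /= ix1 one1 addn1 -/r2 in s2.
have s3 := reaches_step r2 Mq (i := 3) erefl.
have row2 : r2 (row_reg v) + r2 2 = i.+1 * n.
  rewrite /r2 /set_reg /row_reg /index_reg; do 2?case: eqP => ?; try lia.
  by rewrite -/(row_reg v) row1 n1 mulSn addnC.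
rewrite /= row2 -/r3 in s3.
have s4 := reaches_step r3 Mq (i := 4) erefl.
have ix3 : r3 2 - r3 (index_reg v) = n - i.+1.
  rewrite /r3 /r2 /set_reg /row_reg /index_reg.
  by do 4?case: eqP => ?; rewrite ?n1 //; lia.
rewrite /= ix3 -/r4 in s4.
have s5 := reaches_step r4 Mq (i := 5) erefl.
have r43 : r4 3 = n - i.+1 by [].
rewrite /= r43 in s5.
have r14 : preserves v r1 r4.
  do 2![apply: preserves_trans; last by
    apply: preserves_set; rewrite /index_reg /row_reg; lia].
  by apply: preserves_set; rewrite /index_reg; lia.
have rr4 : preserves v r r4 := preserves_trans (preservesS rr1) r14.
rewrite -!addnS in s2 s3 s4 s5.
have run4 := reaches_trans (reaches_trans (reaches_trans (reaches_trans
  (reaches_trans rt jump) s2) s3) s4) s5.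
have [lt_in|le_ni] := ltnP i.+1 n.
  rewrite subn_gt0 lt_in in run4.
  have rep4 := represents_preserved rr4 rep.
  have ix4 : r4 (index_reg v) = i.+1.
    rewrite /r4 /r3 /r2 /set_reg /row_reg /index_reg.
    by do 3?case: eqP => ?; rewrite ?n1 //; lia.
  have row4 : r4 (row_reg v) = i.+1 * n.
    rewrite /r4 /r3 /r2 /set_reg /row_reg /index_reg.
    by do 3?case: eqP => ?; rewrite ?n1 //; lia.
  have [|t' [r' [tT' rt' r'0 rr']]] := IHm (Ordinal lt_in) r4 _ rep4 ix4 row4.
    by rewrite /=; lia.
  exists (t + 1 + 1 + 1 + 1 + 1 + t'), r'; split.
  - by move: tT' tT; rewrite /=; nia.
  - exact: reaches_trans run4 rt'.
  - rewrite r'0 /=; congr (nat_of_bool _); apply/eq_forallb => x.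
    by case: ltngtP => // /ord_inj <-; rewrite bi.
  - exact: preserves_trans rr4 rr'.
rewrite subn_gt0 ltnNge le_ni /= in run4.
exists (t + 1 + 1 + 1 + 1 + 1), r4; split=> //.
- have := ltn_ord i; nia.
- have -> : r4 0 = r1 0.
    by rewrite /r4 /r3 /r2 /set_reg /row_reg /index_reg; do 3?case: eqP => ?; lia.
  rewrite r10 bi; apply/esym/eqP; rewrite eqb1; apply/forallP => x.
  apply/implyP => ix; suff -> : x = i by [].
  by apply: ord_inj; have := ltn_ord x; lia.
Qed.

Lemma compile_correct f v p :
    closed_at v f -> code_at M p (compile v p f) ->
  computes v p (compile v p f) (sat le v f)
    (formula_cost f * n ^ quantifier_depth f).
Proof.
elim: f v p => [i j|f IHf|f IHf g IHg|f IHf] v p /=.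
- move=> /andP[iv jv] Mc env r [r1 r2 re].
  have [_ ei] := re i iv; have [ej _] := re j jv.
  pose ra := set_reg r 3 (env i * n + env j).
  (* The shift by one skips the head of the word, which holds [n]. *)
  pose rb := set_reg ra 3 (env i * n + env j + 1).
  exists 3, (set_reg rb 0 (le (env i) (env j))).
  split=> //.
    have ab := reaches_step r Mc (i := 0) erefl.
    rewrite /= ei ej addn0 -/ra in ab.
    have bc := reaches_step ra Mc (i := 1) erefl.
    have ra31 : ra 3 + ra 1 = env i * n + env j + 1 by rewrite /ra /set_reg /= r1.
    rewrite /= ra31 -/rb addn1 in bc.
    have cd := reaches_step rb Mc (i := 2) erefl.
    rewrite /= (_ : rb 3 = env i * n + env j + 1) ?wE ?addn2 // in cd.
    by rewrite addn3; apply: reaches_trans (reaches_trans ab bc) cd.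
  apply: (@preserves_trans _ _ rb); last exact: preserves_set.
  by apply: (@preserves_trans _ _ ra); apply: preserves_set.
- move=> fv /code_at_cat[/(IHf _ _ fv) cf Mc] env r rep.
  have [t [r' [tT rt r'0 rr']]] := cf _ _ rep.
  exists (t + 1), (set_reg r' 0 (~~ sat le v f env)); split=> //.
  - have : 0 < n ^ quantifier_depth f by rewrite expn_gt0 n_gt0.
    by rewrite mulnDl; nia.
  - apply: reaches_trans rt _.
    have := reaches_step r' Mc (i := 0) erefl.
    rewrite /= r'0 size_cat /= addn0 addn1 addnS (one_reg (represents_preserved rr' rep)).
    by case: (sat _ _ _ _).
  - exact/(preserves_trans rr')/preserves_set.
- move=> /andP[fv gv] /code_at_cat[Mf].
  move=> /(@code_at_cat _ _ [:: _; _])[Mj Mg] env r rep.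
  have cf := IHf _ _ fv Mf.
  have cg := IHg _ _ gv Mg.
  set d := maxn _ _.
  have df : n ^ quantifier_depth f <= n ^ d by rewrite leq_pexp2l ?leq_maxl.
  have dg : n ^ quantifier_depth g <= n ^ d by rewrite leq_pexp2l ?leq_maxr.
  have d0 : 0 < n ^ d by rewrite expn_gt0 n_gt0.
  have [t [r1 [tT rt r10 rr1]]] := cf _ _ rep.
  have rep1 := represents_preserved rr1 rep.
  have := reaches_step r1 Mj (i := 0) erefl; rewrite /= r10.
  case Ef: (sat le v f env) => /= jump; rewrite addn0 in jump.
    have [t' [r2 [tT' rt' r20 rr2]]] := cg _ _ rep1.
    exists (t + 1 + t'), r2; split=> //.
    + by rewrite !mulnDl; nia.
    + have tt' := reaches_trans (reaches_trans rt jump) rt'.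
      by apply: reaches_at tt' _; rewrite size_cat /=; lia.
    + exact: preserves_trans rr1 rr2.
  exists (t + 1 + 1), r1; split=> //; last by rewrite r10 Ef.
    by rewrite !mulnDl; nia.
  have jump' := reaches_step r1 Mj (i := 1) erefl.
  rewrite /= (one_reg rep1) addn1 in jump'.
  apply: reaches_at (reaches_trans (reaches_trans rt jump) jump') _.
  by rewrite size_cat /=; lia.
- move=> fv /(@code_at_cat _ _ [:: _; _])[Mi /code_at_cat[Mf Mt]] env r rep.
  rewrite /= in Mf Mt; set c := compile _ _ _ in Mf Mt *.
  have cf := IHf _ _ fv Mf; set K := _ * _ in cf.
  set q := p + 2 + size c in Mt *.
  pose ri := set_reg r (index_reg v) 0; pose rr := set_reg ri (row_reg v) 0.
  have rri : preserves v r rr.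
    by apply: (@preserves_trans _ _ ri); apply: preserves_set;
       rewrite /index_reg /row_reg; lia.
  have repr := represents_preserved rri rep.
  have ir : rr (index_reg v) = 0.
    by rewrite /rr /ri /set_reg /row_reg /index_reg; do 2?case: eqP => ?; lia.
  have rw : rr (row_reg v) = 0 by rewrite /rr /set_reg eqxx.
  have [t [r' [tT rt r'0 rr']]] := compile_loop cf Mt repr
    (i := Ordinal n_gt0) ir rw.
  exists (1 + 1 + t), r'; split.
  - have nX : n <= n * n ^ quantifier_depth f.
      by rewrite leq_pmulr // expn_gt0 n_gt0.
    rewrite /= subn0 mulnDr /K mulnCA in tT.
    rewrite expnS mulnDl; move: (n * n ^ _) (formula_cost f * _) nX tT => X Y.
    by lia.
  - have := reaches_step r Mi (i := 0) erefl.
    have := reaches_step ri Mi (i := 1) erefl.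
    rewrite /= addn0 addn1 => s2 s1.
    have s12 := reaches_at (reaches_trans s1 s2) (esym (addn2 p)).
    apply: reaches_at (reaches_trans s12 rt) _.
    by rewrite /q size_cat /= -/c; lia.
  - by rewrite r'0.
  - exact: preserves_trans rri rr'.
Qed.

End CompileCorrect.

Lemma iter_step_halted M w t c : halted M c -> iter t (step M w) c = c.
Proof.
move=> hc; elim: t => //= t ->.
by rewrite /step onth_default.
Qed.

Lemma nth_poset_word d (P : finPOrderType d) (e : 'I_#|P| -> P)
    (i j : 'I_#|P|) :
  nth 0 (poset_word e) (i * #|P| + j + 1) = (e i <= e j)%O.
Proof.
rewrite addn1 /=.
have nthE (s : seq 'I_#|P|) k : k < size s -> nth i s k = i ->
    nth 0 [seq nat_of_bool (e i0 <= e j0)%O | i0 <- s, j0 <- enum 'I_#|P|]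
      (k * #|P| + j) = (e i <= e j)%O.
  elim: s k => // i0 s IHs [|k] /= ks nki.
    rewrite mul0n add0n nth_cat size_map size_enum_ord ltn_ord.
    by rewrite (nth_map i) ?size_enum_ord // nth_ord_enum nki.
  rewrite nth_cat size_map size_enum_ord mulSn -addnA ltnNge leq_addr /=.
  by rewrite addKn IHs.
by apply: nthE; rewrite ?size_enum_ord // nth_ord_enum.
Qed.

Lemma eq_sat_ext (T : finType) (le : rel T) v f env env' :
  env =1 env' -> sat le v f env = sat le v f env'.
Proof. by move/funext->. Qed.

Lemma sat_bij (T T' : finType) (le : rel T) (e : T' -> T) v f env :
    bijective e ->
  sat (fun i j => le (e i) (e j)) v f env = sat le v f (e \o env).
Proof.
case=> e' eK e'K; elim: f v env => //= [f IHf|f IHf g IHg|f IHf] v env.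
- by rewrite IHf.
- by rewrite IHf IHg.
have extE x : e \o extend env v x =1 extend (e \o env) v (e x).
  by move=> u; rewrite /extend /=; case: eqP.
apply/forallP/forallP => h x.
  by have := h (e' x); rewrite IHf (eq_sat_ext _ _ _ (extE _)) e'K.
by rewrite IHf (eq_sat_ext _ _ _ (extE _)).
Qed.

Theorem polytime_first_order (A : poset_property) (f : formula) :
    closed_at 0 f ->
    (forall d (P : finPOrderType d) (env : nat -> P),
       A d P = sat <=%O 0 f env) ->
  polytime_decidable A.
Proof.
move=> f0 AE.
(* R_3 is still 0, so the second instruction reads [n] from the head of the word. *)
pose init := [:: IConst 1 1; IInput 2 3].
exists (init ++ compile 0 2 f), (formula_cost f + 2), (quantifier_depth f).
move=> d P e P_gt0 e_bij.
set M := _ ++ _; set w := poset_word e; set n := #|P|.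
have codeM : code_at M 0 M by [].
have [Mi Mf] := code_at_cat codeM.
have wE (i j : 'I_n) : nth 0 w (i * n + j + 1) = (e i <= e j)%O.
  exact: nth_poset_word.
have i0 : 'I_n := Ordinal P_gt0.
pose r0 : nat -> nat := fun=> 0.
pose r := set_reg (set_reg r0 1 1) 2 n.
have rep : represents 0 (fun=> i0) r by split.
have [t [r' [tT rt r'0 _]]] := compile_correct P_gt0 wE f0 Mf rep.
have s1 := reaches_step w r0 Mi (i := 0) erefl.
have s2 := reaches_step w (set_reg r0 1 1) Mi (i := 1) erefl.
have run_t := reaches_trans (reaches_trans s1 s2) rt.
have T_ge : 1 + 1 + t <= (formula_cost f + 2) * n ^ quantifier_depth f.
  by rewrite mulnDl addnC leq_add // leq_pmulr // expn_gt0 P_gt0.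
rewrite /answers_within /run -(subnKC T_ge) addnC iterD.
have -> : iter (1 + 1 + t) (step M w) (Config 0 (fun=> 0)) = Config (size M) r'.
  by apply: etrans run_t _; congr Config; rewrite /M size_cat.
rewrite iter_step_halted ?/halted //=; split=> //.
by rewrite r'0 (AE _ _ (e \o fun=> i0)) -(sat_bij <=%O _ _ _ e_bij).
Qed.

(** * Reductions of inclusion representations *)

Section Tightness.

Variables (d : Order.disp_t) (P : finPOrderType d).
Implicit Types (A B L : {set P}) (x y z t : P) (h : P -> nat).

(** [W] may contain idle tokens, and the type of tokens is arbitrary, so that codes can be glued
    over a disjoint union. *)
Definition embeds A (T : finType) (W : {set T}) (s : P -> {set T}) : Prop :=
  {in A, forall x, s x \subset W} /\
  {in A &, forall x y, (x <= y)%O = (s x \subset s y)}.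

(** The principal code [dn A] uses [#|A|] tokens; when its sizes obey [h], tightness means that it
    is optimal. *)
Definition tight A h : Prop :=
  forall (T : finType) (W : {set T}) (s : P -> {set T}),
    embeds A W s -> {in A, forall x, #|s x| <= h x} -> #|A| <= #|W|.

Definition dn A x : {set P} := [set y in A | (y <= x)%O].

Definition dlt A x : {set P} := [set y in A | (y < x)%O].

Definition maxima A : {set P} := [set x in A | [forall y in A, ~~ (x < y)%O]].

Lemma dn_sub A x y : x \in A -> (dn A x \subset dn A y) = (x <= y)%O.
Proof.
move=> Ax; apply/subsetP/idP => [/(_ x)|xy u]; rewrite !inE ?Ax ?lexx //.
  exact.
by case: (u \in A) => //= /le_trans; apply.
Qed.

Lemma dnE A x : x \in A -> dn A x = x |: dlt A x.
Proof.
by move=> Ax; apply/setP => u; rewrite !inE le_eqVlt; case: eqP => // ->; rewrite Ax.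
Qed.

Lemma card_dn A x : x \in A -> #|dn A x| = #|dlt A x|.+1.
Proof. by move=> Ax; rewrite dnE // cardsU1 !inE ltxx andbF. Qed.

Lemma maximaP A x :
  reflect (x \in A /\ forall y, y \in A -> ~~ (x < y)%O) (x \in maxima A).
Proof. by rewrite inE; apply: (iffP andP) => -[Ax /forall_inP]. Qed.

Lemma maxima_le A x y : x \in maxima A -> y \in A -> (x <= y)%O = (y == x).
Proof.
case/maximaP=> _ mx Ay; rewrite le_eqVlt eq_sym.
by rewrite (negbTE (mx y Ay)) orbF.
Qed.

Lemma maxima_above A x : x \in A -> exists2 y, y \in maxima A & (x <= y)%O.
Proof.
move=> Ax; pose up y := #|[set z in A | (y < z)%O]|.
pose Q := [pred y | (y \in A) && (x <= y)%O].
have Qx : Q x by rewrite /= Ax lexx.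
case: (arg_minnP up Qx) => y /andP[Ay xy] ymin; exists y => //.
apply/maximaP; split=> // z Az; apply/negP => yz.
have := ymin z; rewrite /= Az (ltW (le_lt_trans xy yz)) leqNgt => /(_ isT).
rewrite (proper_card (A := [set u in A | (z < u)%O])) //.
apply/properP; split; last by exists z; rewrite !inE ?Az ?yz ?ltxx ?andbF.
by apply/subsetP => u; rewrite !inE => /andP[-> /(lt_trans yz)].
Qed.

(* If [x] is the join of what lies below it, then the token [x] is redundant. *)
Lemma tight_not_join A h x :
    tight A h -> {in A, forall z, #|dn A z| <= h z} -> x \in A ->
  exists w, [/\ w \in A, ~~ (x <= w)%O & forall u, u \in A -> (u < x)%O -> (u <= w)%O].
Proof.
move=> tA bA Ax; apply: contrapT => no.
have /tA : embeds A (A :\ x) (fun z => dn A z :\ x).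
  split=> [z _|z z' Az Az'].
    by apply: setSD; apply/subsetP => u; rewrite inE => /andP[].
  apply/idP/idP => [zz'|/subsetP sub]; first by rewrite setSD ?dn_sub.
  have [zx|zx] := eqVneq z x; last by have := sub z; rewrite !inE zx Az lexx => /(_ isT).
  apply/negPn/negP => nz; apply: no; exists z'; split=> //; first by rewrite -zx.
  move=> u Au ux; have := sub u; rewrite !inE Au zx (lt_eqF ux) (ltW ux).
  by case/(_ isT).
rewrite (cardsD1 x A) Ax ltnn => sh; suff: false by []; apply: sh => z Az.
by apply: leq_trans (bA _ Az); apply/subset_leq_card/subsetDl.
Qed.

(* Otherwise the tokens of [x] and [z] can be merged into one. *)
Lemma tight_not_merge A h x z :
    tight A h -> {in A, forall z, #|dn A z| <= h z} ->
    x \in A -> z \in A -> x != z ->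
  exists w, w \in A /\
    ([/\ ~~ (x <= w)%O, (z <= w)%O & forall u, u \in A -> (u < x)%O -> (u <= w)%O] \/
     [/\ ~~ (z <= w)%O, (x <= w)%O & forall u, u \in A -> (u < z)%O -> (u <= w)%O]).
Proof.
move=> tA bA Ax Az xz; apply: contrapT => no.
pose s q := if (z <= q)%O then x |: (dn A q :\ z) else dn A q :\ z.
have sE q u : (u \in s q) = (u != z) && (u \in dn A q) || (z <= q)%O && (u == x).
  by rewrite /s; case: ifP => _; rewrite !inE ?orbF // orbC.
have /tA : embeds A (A :\ z) s.
  split=> [q Aq|q q' Aq Aq'].
    apply/subsetP => u; rewrite sE !inE => /orP[/and3P[-> ->]|/andP[_ /eqP->]] //.
    by rewrite xz.
  apply/idP/idP => [qq'|/subsetP sub].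
    apply/subsetP => u; rewrite !sE !inE.
    case/orP=> [/and3P[-> -> uq]|/andP[zq ->]]; first by rewrite (le_trans uq qq').
    by rewrite (le_trans zq qq') orbT.
  apply/negPn/negP => nqq'.
  have [qz|qz] := eqVneq q z; last first.
    have := sub q; rewrite !sE !inE qz Aq lexx (negbTE nqq') /= => /(_ isT).
    case/andP=> zq' /eqP qx; apply: no; exists q'; split=> //; left.
    split=> //; first by rewrite -qx.
    move=> u Au ux; have [-> //|uz] := eqVneq u z.
    have := sub u; rewrite !sE !inE uz Au qx (ltW ux) /= => /(_ isT).
    by rewrite (lt_eqF ux) andbF orbF.
  have := sub x; rewrite !sE !inE xz Ax qz lexx eqxx orbT => /(_ isT).
  rewrite qz in nqq'; rewrite (negbTE nqq') orbF /= => xq'.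
  apply: no; exists q'; split=> //; right; split=> //.
  move=> u Au uz; have [-> //|ux] := eqVneq u x.
  have := sub u; rewrite !sE !inE Au (lt_eqF uz) qz (ltW uz) /= => /(_ isT).
  by rewrite (negbTE nqq') orbF.
rewrite (cardsD1 z A) Az ltnn => sh; suff: false by []; apply: sh => q Aq.
apply: leq_trans (bA _ Aq); rewrite /s; case: ifP => zq; last first.
  exact/subset_leq_card/subsetDl.
rewrite [X in _ <= X](cardsD1 z) inE Az zq cardsU1 leq_add2r.
by case: (_ \notin _).
Qed.

(* The elements of [Z] are maximal; they are given new codes not using [c]. *)
Lemma tight_not_patch A h (Z : {set P}) (p : P -> {set P}) c :
    tight A h -> {in A, forall z, #|dn A z| <= h z} ->
    Z \subset maxima A -> c \in Z ->
    {in Z, forall z, p z \subset A :\ c} ->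
    {in Z, forall z, #|dlt A z| + #|p z| <= h z} ->
    {in Z & A, forall z q, q \notin Z -> ~~ (p z \subset dn A q)} ->
    {in Z & A, forall z q, q \notin Z -> ~~ (q < z)%O ->
       ~~ (dn A q \subset dlt A z :|: p z)} ->
    {in Z &, forall z z', z != z' -> ~~ (p z \subset dlt A z' :|: p z')} ->
  False.
Proof.
move=> tA bA /subsetP Zmax Zc pA ph H1 H2 H3.
have ZA z : z \in Z -> z \in A by move/Zmax; case/maximaP.
pose s q := if q \in Z then dlt A q :|: p q else dn A q.
have /tA : embeds A (A :\ c) s.
  split=> [q Aq|q q' Aq Aq']; rewrite /s.
    case: ifPn => Zq.
      rewrite subUset pA // andbT; apply/subsetP => u; rewrite !inE => /andP[Au uq].
      rewrite Au andbT; apply: contraTneq uq => ->.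
      by have /maximaP[_ ->] := Zmax _ Zc.
    apply/subsetP => u; rewrite !inE => /andP[-> uq]; rewrite andbT.
    apply: contraTneq uq => ->; rewrite (maxima_le (Zmax _ Zc)) //.
    by apply: contraNneq Zq => ->.
  case: ifPn => Zq; case: ifPn => Zq'.
  - rewrite (maxima_le (Zmax _ Zq)) //; case: eqVneq => [->|]; first by rewrite subxx.
    by rewrite eq_sym subUset => /(H3 _ _ Zq Zq')/negbTE->; rewrite andbF.
  - rewrite (maxima_le (Zmax _ Zq)) // subUset (negbTE (H1 _ _ Zq Aq' Zq')) andbF.
    by apply: contraNF Zq' => /eqP->.
  - have qq' : q != q' by apply: contraNneq Zq => ->.
    rewrite le_eqVlt (negbTE qq') /=; case: (boolP (q < q')%O) => [lt|nlt]; last first.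
      by rewrite (negbTE (H2 _ _ Zq' Aq Zq nlt)).
    apply/esym; rewrite subsetU //; apply/orP; left; apply/subsetP => u.
    by rewrite !inE => /andP[-> uq] /=; apply: le_lt_trans uq lt.
  - by rewrite dn_sub.
rewrite (cardsD1 c A) (ZA _ Zc) ltnn => sh.
suff: false by []; apply: sh => q Aq.
rewrite /s; case: ifP => [Zq|_]; last exact: bA.
by apply: leq_trans (ph _ Zq); rewrite cardsU leq_subr.
Qed.

End Tightness.

(** * Codes over a disjoint union of token sets *)

Section SumTokens.

Variables (T U : finType).
Implicit Types (X : {set T}) (Y : {set U}).

Definition joint X Y : {set T + U} :=
  [set u | match u with inl a => a \in X | inr b => b \in Y end].

Lemma joint_sub X Y X' Y' :
  (joint X Y \subset joint X' Y') = (X \subset X') && (Y \subset Y').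
Proof.
apply/subsetP/andP => [sub|[/subsetP XX /subsetP YY] [a|b]]; last 2 first.
- by rewrite !inE; apply: XX.
- by rewrite !inE; apply: YY.
split; apply/subsetP => u Xu.
  by have := sub (inl u); rewrite !inE; apply.
by have := sub (inr u); rewrite !inE; apply.
Qed.

Lemma card_joint X Y : #|joint X Y| = #|X| + #|Y|.
Proof.
have -> : joint X Y = inl @: X :|: inr @: Y.
  apply/setP => -[a|b]; rewrite !inE.
    rewrite mem_imset; last by move=> ? ? [].
    by case: (inl a \in inr @: Y) /imsetP => [[]|]; rewrite ?orbF.
  rewrite [X in _ || X]mem_imset; last by move=> ? ? [].
  by case: (inr b \in inl @: X) /imsetP => [[]|].
rewrite cardsU !card_imset; try by move=> ? ? [].
rewrite [X in _ - X](_ : _ = 0) ?subn0 //; apply: eq_card0 => u.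
by rewrite inE; apply/negP => /andP[/imsetP[a _ ->] /imsetP[]].
Qed.

End SumTokens.

(** * Passing tightness to a smaller poset *)

Section UpperBounds.

Variables (d : Order.disp_t) (P : finPOrderType d).
Implicit Types (A B L : {set P}) (x y z t : P) (h : nat).

Definition below L B := {in L & B, forall x y, (x < y)%O}.

(** Everything strictly below [t] is below [y], so any code of [A :\ t] extends to [A] by giving [t]
    the set of [y] and one fresh token. The extension costs one token and one unit of height. *)
Lemma tight_remove A h t y :
    tight A (fun=> h.+1) -> t \in maxima A -> y \in A -> (y < t)%O ->
    {in A, forall u, (u < t)%O -> (u <= y)%O} ->
  tight (A :\ t) (fun=> h).
Proof.
move=> tA tmax Ay yt ymax T W s [sW sE] sh.
have At : t \in A by case/maximaP: tmax.
have A'y : y \in A :\ t by rewrite !inE (lt_eqF yt).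
have A'P q : q \in A -> q != t -> q \in A :\ t by rewrite !inE => -> ->.
pose s' q := if q == t then joint (s y) [set: unit] else joint (s q) set0.
have /tA : embeds A (joint W [set: unit]) s'.
  split=> [q Aq|q q' Aq Aq']; rewrite /s'.
    by case: eqP => [_|/eqP qt]; rewrite joint_sub sW ?sub0set ?subxx //; apply: A'P.
  case: eqVneq => [->|qt]; case: eqVneq => [->|qt'].
  - by rewrite lexx subxx.
  - rewrite (maxima_le tmax) // (negbTE qt') joint_sub subTset andbC eq_sym.
    by rewrite -cards_eq0 cardsT card_unit.
  - rewrite joint_sub sub0set andbT -sE ?(A'P q) // le_eqVlt (negbTE qt) /=.
    by apply/idP/idP => [/ymax->|/le_lt_trans->].
  - by rewrite joint_sub subxx andbT -sE ?A'P.
rewrite card_joint cardsT card_unit (cardsD1 t A) At addnC leq_add2r; apply.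
move=> q Aq; rewrite /s'; case: eqVneq => [_|qt]; rewrite card_joint.
  by rewrite cardsT card_unit addn1 ltnS sh.
by rewrite cards0 addn0 (leq_trans (sh _ _)) ?A'P.
Qed.

(** A cheaper code of [L] could be placed under the principal code of [B], each element of [B]
    receiving all its tokens. No set would exceed [h], because every down-set of an element of [B]
    contains [L]. The bound [#|L|] in the conclusion is harmless: a cheaper code satisfies it
    anyway. *)
Lemma tight_lower A L B h :
    tight A (fun=> h) -> {in A, forall z, #|dn A z| <= h} ->
    A = L :|: B -> below L B -> B != set0 ->
  tight L (fun=> #|L|).
Proof.
move=> tA bA AE LB B0 T W s [sW sE] _; rewrite leqNgt; apply/negP => WL.
have disLB x : x \in L -> x \in B -> False by move=> Lx /(LB _ _ Lx); rewrite ltxx.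
have [b Bb] := set0Pn _ B0.
have dnB z : z \in B -> #|L| + #|dn B z| <= #|dn A z|.
  move=> Bz; have <- : #|L :|: dn B z| = #|L| + #|dn B z|.
    rewrite cardsU (_ : L :&: _ = set0) ?cards0 ?subn0 //; apply/setP => u.
    by rewrite !inE; apply/negP => /and3P[Lu /(disLB _ Lu)].
  apply/subset_leq_card/subsetP => u; rewrite AE !inE.
  by case/orP => [Lu|/andP[-> ->]]; rewrite ?orbT // Lu ltW // LB.
have Lh : #|L| <= h.
  apply: leq_trans (bA b _); last by rewrite AE inE Bb orbT.
  by apply: leq_trans (dnB _ Bb); apply: leq_addr.
pose s' q := if q \in L then joint (s q) set0 else joint W (dn B q).
have /tA : embeds A (joint W B) s'.
  rewrite AE; split=> [q|q q']; rewrite /s' !in_setU.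
    case: ifP => [Lq _|_]; first by rewrite joint_sub sW ?sub0set.
    by rewrite joint_sub subxx => _; apply/subsetP => u; rewrite inE => /andP[].
  case: ifP => [Lq _|Lq /= Bq]; case: ifP => [Lq' _|Lq' /= Bq'].
  - by rewrite joint_sub subxx andbT -sE.
  - by rewrite joint_sub sub0set sW ?ltW ?LB.
  - rewrite joint_sub subset0 -cards_eq0 (card_dn Bq) andbF.
    by apply/negP => /(lt_le_trans (LB _ _ Lq' Bq)); rewrite ltxx.
  - by rewrite joint_sub subxx dn_sub.
have sh : {in A, forall x, #|s' x| <= h}.
  move=> q; rewrite AE inE /s'; case: ifP => [Lq _|_ /= Bq].
    rewrite card_joint cards0 addn0.
    by apply: leq_trans (subset_leq_card (sW _ Lq)) _; lia.
  rewrite card_joint; apply: leq_trans (bA q _); last by rewrite AE inE Bq orbT.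
  by apply: leq_trans (dnB _ Bq); rewrite leq_add2r ltnW.
move=> /(_ sh); rewrite card_joint AE cardsU (_ : L :&: B = set0).
  by rewrite cards0; lia.
by apply/setP => u; rewrite !inE; apply/negP => /andP[/disLB].
Qed.

(** By descent: [t] is not the join of what lies below it, which forces the rest to have a greatest
    element too, and [tight_remove] deletes [t]. *)
Lemma tight_no_greatest A h t :
    tight A (fun=> h) -> {in A, forall z, #|dn A z| <= h} -> t \in A ->
  ~ {in A, forall u, (u <= t)%O}.
Proof.
have [n] := ubnP #|A|; elim: n A h t => // n IHn A h t /ltnSE An tA bA At top.
have [w [Aw tw wP]] := tight_not_join tA bA At.
have tmax : t \in maxima A.
  by apply/maximaP; split=> // y /top yt; apply/negP => /lt_le_trans/(_ yt); rewrite ltxx.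
have {wP} wP : {in A, forall u, (u < t)%O -> (u <= w)%O} by move=> u /wP.
have wt : (w < t)%O.
  by rewrite lt_neqAle top // andbT; apply: contraNneq tw => ->.
have h_gt0 : 0 < h by apply: leq_trans (bA t At); rewrite card_dn.
case: h h_gt0 => // h _ in tA bA.
have A'w : w \in A :\ t by rewrite !inE (lt_eqF wt).
apply: (IHn (A :\ t) h w) => //.
- by rewrite [X in X <= _](cardsD1 t) At in An.
- exact: tight_remove tA tmax Aw wt wP.
- move=> z; rewrite !inE => /andP[zt Az]; rewrite -ltnS.
  apply: leq_trans (bA t At); apply: proper_card; apply/properP; split.
    by apply/subsetP => u; rewrite !inE => /andP[/andP[_ Au] _]; rewrite Au top.
  by exists t; rewrite !inE ?eqxx ?At ?lexx.
- by move=> u; rewrite !inE => /andP[ut Au]; apply: wP; rewrite // lt_neqAle ut top.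
Qed.

End UpperBounds.

(** * The shape of the topmost block of a tight poset *)

Section LastBlock.

Variables (d : Order.disp_t) (P : finPOrderType d).
Implicit Types (A B L Z : {set P}) (x y z t : P) (h : nat).

Definition antichain B := {in B &, forall x y, (x <= y)%O -> x = y}.

Definition star B := exists c, [/\ c \in B, exists2 y, y \in B & y != c,
  {in B, forall y, y != c -> (y >< c)%O} &
  {in B &, forall y z, y != c -> z != c -> (y >=< z)%O}].

Definition kite B := exists a x b c, B = [set a; x; b; c] /\
  [/\ (a < x)%O, (a >< b)%O, (a >< c)%O, (x >< b)%O & (x >< c)%O /\ (b >< c)%O].

Lemma incomparable_neq x y : (x >< y)%O -> x != y.
Proof. by apply: contraNneq => ->; rewrite comparablexx. Qed.

Lemma incomparable_sym x y : (x >< y)%O = (y >< x)%O.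
Proof. by rewrite comparable_sym. Qed.

Lemma incomparableE x y : (x >< y)%O = ~~ (x <= y)%O && ~~ (y <= x)%O.
Proof. by rewrite /Order.comparable negb_or. Qed.

(* Used to recode the elements of [Z], isolated in the last block, by pairs. *)
Lemma tight_not_pairs A L B h Z (p : P -> {set P}) c :
    tight A (fun=> h) -> {in A, forall z, #|dn A z| <= h} ->
    A = L :|: B -> below L B -> #|L| + 2 <= h -> Z \subset B -> c \in Z ->
    {in Z & B, forall z u, z != u -> (z >< u)%O} ->
    {in Z, forall z, [/\ p z \subset B :\ c, #|p z| <= 2 &
                         exists2 u, u \in Z & u \in p z]} ->
    {in Z & B, forall z q, q \notin Z ->
       exists2 u, u \in B & (u <= q)%O && (u \notin p z)} ->
    {in Z &, forall z z', z != z' -> exists2 u, u \in p z & u \notin p z'} ->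
  False.
Proof.
move=> tA bA AE LB Lh /subsetP ZB Zc iso pP H2 H3.
have disLB x : x \in B -> (x \in L) = false.
  by move=> Bx; apply/negP => /LB/(_ Bx); rewrite ltxx.
have Zmax z : z \in Z -> z \in maxima A.
  move=> Zz; apply/maximaP; split=> [|u]; rewrite AE inE ?(ZB _ Zz) ?orbT //.
  case/orP => [Lu|Bu].
    by apply/negP => /lt_trans/(_ (LB _ _ Lu (ZB _ Zz))); rewrite ltxx.
  have [<-|/(iso _ _ Zz Bu)] := eqVneq z u; first by rewrite ltxx.
  by rewrite incomparableE => /andP[zu _]; apply: contraNN zu => /ltW.
have dltZ z : z \in Z -> dlt A z = L.
  move=> Zz; apply/setP => u; rewrite AE !inE.
  have [Lu|Lu] /= := boolP (u \in L); first by rewrite LB ?ZB.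
  apply/negP => /andP[Bu uz]; have := iso _ _ Zz Bu.
  rewrite (gt_eqF uz) => /(_ isT); rewrite incomparableE => /andP[_].
  by rewrite (ltW uz).
apply: (tight_not_patch tA bA _ Zc (p := p)).
- by apply/subsetP.
- move=> z /pP[pz _ _]; apply: subset_trans pz _; apply: setSD.
  by rewrite AE subsetUr.
- move=> z Zz; rewrite dltZ //; apply: leq_trans Lh; rewrite leq_add2l.
  by have [] := pP _ Zz.
- move=> z q /pP[_ _ [u Zu pu]] Aq; apply: contraNN => /subsetP/(_ _ pu).
  by rewrite inE (maxima_le (Zmax _ Zu)) // => /andP[_ /eqP->].
- move=> z q Zz Aq Zq qz; have Bq : q \in B.
    by move: Aq qz; rewrite AE inE => /orP[/LB/(_ (ZB _ Zz))->|].
  have [u Bu /andP[uq pu]] := H2 _ _ Zz Bq Zq.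
  apply/subsetPn; exists u; first by rewrite inE uq AE inE Bu orbT.
  by rewrite in_setU dltZ // disLB.
- move=> z z' Zz Zz' zz'; have [u pu pu'] := H3 _ _ Zz Zz' zz'.
  apply/subsetPn; exists u => //; rewrite inE (negbTE pu') orbF dltZ // disLB //.
  by have [/subsetP/(_ _ pu)] := pP _ Zz; rewrite inE => /andP[].
Qed.

(** The strict down-sets of the maximal elements form a chain. If they all agree, the maximal
    elements are the block. Otherwise a single maximal element [t] lies above all non-maximal ones;
    it can be deleted, and the last block of the rest, which contains the greatest non-maximal
    element, takes [t] back. *)
Lemma last_block A h :
    A != set0 -> tight A (fun=> h) -> {in A, forall z, #|dn A z| <= h} ->
  exists L B, [/\ A = L :|: B, below L B, B != set0, tight L (fun=> #|L|) &
    (antichain B /\ 1 < #|B|) \/ (star B \/ kite B)].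
Proof.
have [n] := ubnP #|A|; elim: n A h => // n IHn A h /ltnSE An A0 tA bA.
pose M := maxima A; pose D := dlt A.
have MA z : z \in M -> z \in A by case/maximaP.
have DM z : z \in M -> D z \subset A :\: M.
  move=> Mz; apply/subsetP => u; rewrite inE => /andP[Au uz].
  rewrite inE Au andbT; apply/negP => /maximaP[_ /(_ z (MA _ Mz))].
  by rewrite uz.
(* The witness against merging two maximal elements lies above one of them, hence equals it. *)
have nested x z : x \in M -> z \in M -> (D x \subset D z) \/ (D z \subset D x).
  move=> Mx Mz; have [->|xz] := eqVneq x z; first by left.
  have key x' z' w : z' \in M -> x' \in M -> w \in A -> (z' <= w)%O ->
      (forall u, u \in A -> (u < x')%O -> (u <= w)%O) -> D x' \subset D z'.
    move=> Mz' Mx' Aw; rewrite (maxima_le Mz' Aw) => /eqP-> wP.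
    apply/subsetP => u Du; have /setDP[_ Mu] := subsetP (DM _ Mx') _ Du.
    move: Du; rewrite !inE => /andP[Au ux]; rewrite Au lt_neqAle (wP u) // andbT.
    by apply: contraNneq Mu => ->.
  have [w [Aw [[_ zw wP]|[_ xw wP]]]] := tight_not_merge tA bA (MA _ Mx) (MA _ Mz) xz.
    by left; apply: key zw wP.
  by right; apply: key xw wP.
have [t Mt Dt] : exists2 t, t \in M & D t = A :\: M.
  have [a Aa] := set0Pn _ A0; have [m0 Mm0 _] := maxima_above Aa.
  case: (arg_maxnP (fun z => #|D z|) Mm0) => t Mt tmax; exists t => //.
  apply/eqP; rewrite eqEsubset DM //; apply/subsetP => u /setDP[Au Mu].
  have [m Mm um] := maxima_above Au.
  have {um} um : u \in D m.
    by rewrite inE Au lt_neqAle um andbT; apply: contraNneq Mu => ->.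
  have [/subsetP|tm] := nested _ _ Mm Mt; first exact.
  suff <- : D m = D t by [].
  by apply/esym/eqP; rewrite eqEcard tm; apply: tmax.
have At := MA _ Mt.
have [/forall_inP allT|] := boolP [forall x in M, D x == A :\: M].
  have M0 : M != set0 by apply/set0Pn; exists t.
  have AE : A = (A :\: M) :|: M.
    apply/setP => u; rewrite in_setU in_setD.
    by case: (boolP (u \in M)) => [/MA->|]; rewrite ?orbF.
  have LM : below (A :\: M) M.
    by move=> l m Ll /allT/eqP DmE; move: Ll; rewrite -DmE inE => /andP[].
  exists (A :\: M), M; split=> //; first exact: tight_lower tA bA AE LM M0.
  left; split=> [x y Mx My|].
    by rewrite (maxima_le Mx (MA _ My)) => /eqP.
  rewrite ltnNge; apply/negP => M1; apply: (tight_no_greatest tA bA At) => u Au.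
  have [m Mm um] := maxima_above Au.
  by rewrite (card_le1P M1 t Mt m) in Mm; rewrite -(eqP Mm).
case/forall_inPn => x Mx DxT.
(* Otherwise [x] could be recoded as [D x] with the tokens of [z] and [t], dropping its own token.
   The size is allowed because [D x] is strictly smaller than [D t]. *)
have uniqT z : z \in M -> z != t -> D z != A :\: M.
  move=> Mz zt; apply/negP => /eqP DzT.
  have Dxt : #|D x| < #|D t|.
    by apply: proper_card; rewrite properEneq Dt DM // andbT.
  have xt : x != t by apply: contraNneq DxT => ->; apply/eqP.
  have xz : x != z by apply: contraNneq DxT => ->; apply/eqP.
  have Dx2 m : m \in M -> D m = A :\: M -> ~~ (D m \subset D x :|: [set z; t]).
    move=> Mm DmE; apply/negP => sub; have: #|D m| <= #|D x|.
      apply/subset_leq_card/subsetP => u Du; have := subsetP sub u Du.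
      rewrite DmE in Du; case/setDP: Du => _ Mu.
      rewrite in_setU in_set2 => /or3P[|/eqP uE|/eqP uE] //.
        by rewrite uE Mz in Mu.
      by rewrite uE Mt in Mu.
    by rewrite DmE -Dt leqNgt Dxt.
  apply: (tight_not_patch tA bA (Z := [set x]) (c := x) (p := fun=> [set z; t])).
  - by rewrite sub1set.
  - exact: set11.
  - move=> _ _; apply/subsetP => u /set2P[]->; rewrite !inE MA // andbT.
      by rewrite eq_sym.
    by rewrite eq_sym.
  - move=> _ /set1P->; rewrite cards2 zt; apply: leq_trans (bA _ At).
    by rewrite card_dn // addn2 ltnS.
  - move=> _ q _ Aq _; rewrite subUset !sub1set !inE (maxima_le Mz) //.
    rewrite (maxima_le Mt) // (MA _ Mz) At /=; apply/negP => /andP[/eqP-> /eqP].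
    by apply/eqP.
  - move=> _ q /set1P-> Aq qx nqx; apply/negP => /subsetP sub.
    have := sub q; rewrite inE Aq lexx => /(_ isT).
    rewrite in_setU in_set2 inE Aq (negbTE nqx) /= => qzt.
    have [Mq Dq] : q \in M /\ D q = A :\: M by case/orP: qzt => /eqP->.
    have /negP := Dx2 q Mq Dq; apply; apply/subsetP => u; rewrite !inE => /andP[Au uq].
    by have := sub u; rewrite !inE Au ltW //=; apply.
  - by move=> _ _ /set1P-> /set1P->; rewrite eqxx.
have xt : x != t by apply: contraNneq DxT => ->; apply/eqP.
(* This [y] turns out to be the greatest non-maximal element, so it is incomparable to every maximal
   element except [t]. *)
have [y [Ay ty yP]] := tight_not_join tA bA At.
have Ny : y \notin M.
  apply: contraNN ty => My; rewrite (maxima_le Mt) //.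
  apply: contraT => /(uniqT _ My)/negP[]; rewrite eqEsubset DM //=.
  apply/subsetP => u AMu; have: u \in D t by rewrite Dt.
  case/setDP: AMu => Au Mu; rewrite !inE Au => /andP[_ ut].
  by rewrite lt_neqAle yP // andbT; apply: contraNneq Mu => ->.
have yt : (y < t)%O.
  by have: y \in D t; [rewrite Dt inE Ny Ay|rewrite inE => /andP[]].
have DtP u : u \in A -> u \notin M -> (u <= y)%O.
  move=> Au Mu; apply: yP => //.
  by have: u \in D t; [rewrite Dt inE Mu Au|rewrite inE => /andP[]].
have Myz z : z \in M -> z != t -> (z >< y)%O.
  move=> Mz zt; rewrite incomparableE (maxima_le Mz Ay).
  have yz : y != z by apply: contraNneq Ny => ->.
  rewrite yz; apply: contra (uniqT _ Mz zt) => yz'.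
  rewrite eqEsubset DM //=; apply/subsetP => u /setDP[Au Mu]; rewrite inE Au.
  by apply: le_lt_trans (DtP u Au Mu) _; rewrite lt_neqAle yz.
have Mtz z : z \in M -> z != t -> (z >< t)%O.
  move=> Mz zt; rewrite incomparableE (maxima_le Mz) // (maxima_le Mt) ?MA //.
  by rewrite eq_sym zt.
have h_gt0 : 0 < h by apply: leq_trans (bA t At); rewrite card_dn.
have tA' : tight (A :\ t) (fun=> h.-1).
  by apply: (tight_remove (y := y)) => //; rewrite prednK.
have bA' : {in A :\ t, forall z, #|dn (A :\ t) z| <= h.-1}.
  move=> z /setD1P[zt Az]; rewrite -ltnS prednK //.
  apply: leq_trans (bA t At); rewrite (card_dn At).
  have [Mz|Mz] := boolP (z \in M).
    apply: (@leq_ltn_trans #|dn A z|).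
      by apply/subset_leq_card/subsetP => u; rewrite !inE => /andP[/andP[_ ->]].
    rewrite card_dn // ltnS; apply: proper_card; apply/properP; split.
      by rewrite -/D Dt DM.
    exists y; rewrite inE Ay //=; apply/negP => yz; have := Myz z Mz zt.
    by rewrite incomparableE (ltW yz) andbF.
  rewrite ltnS; apply/subset_leq_card/subsetP => u; rewrite !inE.
  case/andP=> /andP[_ Au] uz; rewrite Au /=.
  exact: le_lt_trans uz (le_lt_trans (DtP _ Az Mz) yt).
have A'y : y \in A :\ t by rewrite !inE Ay (lt_eqF yt).
have A't z : z \in M -> z != t -> z \in A :\ t by move=> Mz zt; rewrite !inE zt MA.
have [||//|L [B [AE LB B0 tL shape]]] := IHn (A :\ t) h.-1 _ _ tA'.
  by rewrite [X in X <= _](cardsD1 t) At in An.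
  by apply/set0Pn; exists y.
have inA' u : u \in B -> u \in A :\ t by rewrite AE inE orbC => ->.
(* With [y] in [L], all of [B] would exceed [y]; but a member of [B] is either maximal and
   incomparable to [y], or below [y]. *)
have By : y \in B.
  have := A'y; rewrite AE inE => /orP[Ly|//].
  have [b Bb] := set0Pn _ B0; have /setD1P[bt Ab] := inA' b Bb.
  have yb := LB _ _ Ly Bb; have [Mb|Mb] := boolP (b \in M).
    by have := Myz b Mb bt; rewrite incomparableE (ltW yb) andbF.
  by have := lt_le_trans yb (DtP b Ab Mb); rewrite ltxx.
have MB z : z \in M -> z != t -> z \in B.
  move=> Mz zt; have := A't z Mz zt; rewrite AE inE => /orP[Lz|//].
  have := Myz z Mz zt; rewrite incomparableE.
  by rewrite (ltW (LB _ _ Lz By)).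
have BP q : q \in B -> q \notin M -> (q <= y)%O.
  by move=> /inA'/setD1P[_ Aq] Mq; apply: DtP.
have tB : t \notin B by apply/negP => /inA'; rewrite !inE eqxx.
have AE' : A = L :|: (t |: B) by rewrite setUCA -AE setD1K.
have LB' : below L (t |: B).
  move=> l q Ll /setU1P[->|]; last exact: LB.
  exact: lt_trans (LB _ _ Ll By) yt.
exists L, (t |: B); split=> //; first by apply/set0Pn; exists t; rewrite setU11.
have yt_neq : y != t by rewrite (lt_eqF yt).
have Lh : #|L| + 2 <= h.
  have c2 : #|[set y; t]| = 2 by rewrite cards2 yt_neq.
  apply: leq_trans (bA t At); rewrite -c2.
  have <- : #|L :|: [set y; t]| = #|L| + #|[set y; t]|.
    rewrite cardsU (_ : L :&: _ = set0) ?cards0 ?subn0 //; apply/setP => u.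
    rewrite in_set0; apply/negP => /setIP[Lu uyt]; have := LB' u u Lu.
    rewrite ltxx => uB; suff: false by []; apply: uB.
    by case/set2P: uyt => ->; rewrite ?setU11 // setU1r.
  apply/subset_leq_card/subsetP => u /setUP[Lu|/set2P[]->]; last 2 first.
  - by rewrite inE Ay ltW.
  - by rewrite inE At lexx.
  by rewrite inE AE' inE Lu ltW // LB' // setU11.
have inM q : q \in B -> ~~ (q <= y)%O -> q \in M /\ q != t.
  move=> Bq qy; split; first by apply: contraNT qy => Mq; apply: BP.
  by apply: contraNneq tB => <-.
have xB := MB _ Mx xt.
have xy := incomparable_neq (Myz _ Mx xt).
have cmp_ty : (t >=< y)%O by rewrite comparable_sym lt_comparable.
right; case: shape => [[antiB _]|[[c [Bc _ starB chainB]]|]].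
(* Antichain: the block becomes the chain [y < t] beside isolated elements. One of these gives a
   star, two give a kite, and three are excluded by recoding. *)
- have BM q : q \in B -> q = y \/ q \in M.
    move=> Bq; have [|Mq] := boolP (q \in M); first by right.
    by left; apply: antiB (BP q Bq Mq).
  have iso z u : z \in M -> z != t -> u \in t |: B -> z != u -> (z >< u)%O.
    move=> Mz zt /setU1P[->|Bu zu]; first by move=> _; apply: Mtz.
    have Bz := MB z Mz zt.
    rewrite incomparableE; apply/andP; split; apply: contraNN zu.
      by move/(antiB z u Bz Bu)->.
    by move/(antiB u z Bu Bz)->.
  have [/exists_inP[z Mz /andP[zt zx]]|noz] :=
      boolP [exists z in M, (z != t) && (z != x)]; last first.
    left; exists x; split; first by rewrite inE xB orbT.
    - by exists t; rewrite ?setU11 // eq_sym.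
    - move=> q Bq qx; rewrite incomparable_sym iso // eq_sym //.
    - have two q : q \in t |: B -> q != x -> q = t \/ q = y.
        move=> /setU1P[|/BM[]]; [by left|by right|move=> Mq qx; left].
        apply/eqP; apply: contraNT noz => qt; apply/exists_inP.
        by exists q; rewrite ?qt.
      move=> q q' Bq Bq' qx qx'.
      by case: (two q Bq qx) => ->; case: (two q' Bq' qx') => ->;
        rewrite ?comparablexx // comparable_sym.
  have [/exists_inP[w Mw /and3P[wt wx wz]]|now] :=
      boolP [exists w in M, [&& w != t, w != x & w != z]]; last first.
    right; exists y, t, x, z; split.
      apply/setP => q; rewrite in_setU1 !inE; apply/idP/idP.
        case/orP=> [->|Bq]; first by rewrite orbT.
        case: (BM q Bq) => [->|Mq]; first by rewrite eqxx.
        have [->|qx] := eqVneq q x; first by rewrite !orbT.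
        have [->|qz] := eqVneq q z; first by rewrite !orbT.
        have qt : q != t by apply: contraNneq tB => <-.
        case/negP: now; apply/exists_inP; exists q; rewrite // qt qx qz //.
      case/orP=> [/orP[/orP[]|]|] /eqP->; rewrite ?eqxx ?By ?orbT //.
        by rewrite xB orbT.
      by rewrite MB ?orbT.
    split=> //; try by rewrite incomparable_sym (Myz, Mtz).
    split; first by rewrite incomparable_sym Mtz.
    by apply: iso => //; rewrite ?setU1r ?MB // eq_sym.
  exfalso; have zB := MB _ Mz zt; have wB := MB _ Mw wt.
  have zy := incomparable_neq (Myz _ Mz zt).
  pose p q := if q == x then [set t; x] else if q == z then [set t; z] else [set x; z].
  have px : p x = [set t; x] by rewrite /p eqxx.
  have pz : p z = [set t; z] by rewrite /p (negbTE zx) eqxx.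
  have pw : p w = [set x; z] by rewrite /p (negbTE wx) (negbTE wz).
  have ZP u : u \in [set x; z; w] -> [\/ u = x, u = z | u = w].
    by rewrite !inE -orbA => /or3P[]/eqP->; constructor.
  apply: (@tight_not_pairs A L (t |: B) h [set x; z; w] p w) => //.
  + by apply/subsetP => u /ZP[]->; apply: setU1r.
  + by rewrite !inE eqxx !orbT.
  + by move=> v u /ZP[]-> Bu; apply: iso.
  + move=> v /ZP[]->; split; rewrite ?px ?pz ?pw ?cards2 ?leq_b1 //;
      try by case: (_ != _).
    * by rewrite subUset !sub1set !inE eqxx xB ![_ == w]eq_sym wt wx orbT.
    * by exists x; rewrite !inE eqxx ?orbT.
    * by rewrite subUset !sub1set !inE eqxx zB ![_ == w]eq_sym wt wz orbT.
    * by exists z; rewrite !inE eqxx ?orbT.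
    * by rewrite subUset !sub1set !inE xB zB ![_ == w]eq_sym wx wz !orbT.
    * by exists x; rewrite !inE eqxx ?orbT.
  + move=> v q /ZP pP Bq Zq.
    case/setU1P: (Bq) => [->|Bq'].
      exists y; rewrite ?setU1r // (ltW yt) /=.
      by case: pP => ->; rewrite ?px ?pz ?pw in_set2 negb_or ?yt_neq eq_sym // xy eq_sym.
    exists q => //; rewrite lexx /=; have qt : q != t by apply: contraNneq tB => <-.
    move: Zq; rewrite !inE !negb_or -andbA => /and3P[qx qz qw].
    by case: pP => ->; rewrite ?px ?pz ?pw in_set2 negb_or ?qt ?qx ?qz.
  + have [tx tz] : t != x /\ t != z by rewrite ![t == _]eq_sym.
    move=> v v' /ZP[]-> /ZP[]->; rewrite ?eqxx // ?px ?pz ?pw => _.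
    * by exists x; rewrite !inE ?eqxx ?orbT // negb_or xt eq_sym.
    * by exists t; rewrite !inE ?eqxx // negb_or tx.
    * by exists z; rewrite !inE ?eqxx ?orbT // negb_or zt.
    * by exists t; rewrite !inE ?eqxx // negb_or tx.
    * by exists z; rewrite !inE ?eqxx ?orbT // negb_or zt.
    * by exists x; rewrite !inE ?eqxx ?orbT // negb_or xt eq_sym.
(* If [y] is the centre, the other elements are maximal and form a chain, so [x] is the only one and
   becomes the new centre. If not, the centre is maximal and [t] prolongs the chain. *)
- left; have [yc|yc] := eqVneq y c.
    have two q : q \in t |: B -> q != x -> q = t \/ q = y.
      move=> /setU1P[|Bq qx]; first by left.
      right; apply/eqP; apply: contraT => qy.
      have := starB q Bq; rewrite -yc => /(_ qy); rewrite incomparableE.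
      case/andP=> /(inM _ Bq)[Mq qt] _.
      have := chainB q x Bq xB; rewrite -yc => /(_ qy xy).
      rewrite /Order.comparable (maxima_le Mq) ?MA // (maxima_le Mx) ?MA //.
      by rewrite eq_sym orbb (negbTE qx).
    exists x; split; first by rewrite inE xB orbT.
    + by exists t; rewrite ?setU11 // eq_sym.
    + move=> q /two tq /tq[]->; first by rewrite incomparable_sym Mtz.
      by rewrite incomparable_sym Myz.
    + move=> q q' /two tq /two tq' /tq[]-> /tq'[]->; rewrite ?comparablexx //.
      by rewrite comparable_sym.
  have [Mc ct] : c \in M /\ c != t.
    apply: inM => //; have := starB y By yc.
    by rewrite incomparableE => /andP[].
  exists c; split; first by rewrite inE Bc orbT.
  + by exists t; rewrite ?setU11 // eq_sym.
  + move=> q /setU1P[->|Bq] qc; last exact: starB.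
    by rewrite incomparable_sym Mtz.
  + have tq q : q \in B -> q != c -> (t >=< q)%O.
      move=> Bq qc; rewrite comparable_sym lt_comparable //.
      apply: le_lt_trans yt; apply: BP => //; apply/negP => Mq.
      have qt : q != t by apply: contraNneq tB => <-.
      by have /negP[] := Myz q Mq qt; apply: chainB.
    move=> q q' /setU1P[->|Bq] /setU1P[->|Bq'] qc qc'; rewrite ?comparablexx //.
    * exact: tq.
    * by rewrite comparable_sym tq.
    * exact: chainB.
(* A kite cannot grow. Only [y = x'] is consistent with the order; then [a < x' < t] is a chain
   beside [b] and [c], and the pairs [{x', b}] and [{t, b}] save the token of [c]. The token of [a]
   keeps the chain from slipping below them. *)
- case=> a [x' [b [c [BE [ax ab ac xb [xc bc]]]]]]; exfalso.
  have [Ba Bx Bb Bc] : [/\ a \in B, x' \in B, b \in B & c \in B].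
    by rewrite BE !inE !eqxx ?orbT.
  have notM q : q \in B -> (y >< q)%O -> q \in M /\ q != t.
    by move=> Bq; rewrite incomparableE => /andP[_ /(inM _ Bq)].
  have aM : a \notin M.
    have /setD1P[_ Ax'] := inA' _ Bx.
    by apply/negP => /maximaP[_ /(_ x' Ax')]; rewrite ax.
  have := By; rewrite BE !inE -!orbA => /or4P[]/eqP yE.
  + rewrite yE in inM Myz *; have [Mx' xt'] : x' \in M /\ x' != t.
      by apply: inM; rewrite // lt_geF.
    by have := Myz _ Mx' xt'; rewrite incomparableE (ltW ax) andbF.
  + have [[Mb bt] [Mc ct]] : (b \in M /\ b != t) /\ (c \in M /\ c != t).
      by split; apply: notM; rewrite // yE.
    have [xb' xc'] := (incomparable_neq xb, incomparable_neq xc).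
    have [ab' ac'] := (incomparable_neq ab, incomparable_neq ac).
    have bc' := incomparable_neq bc.
    have [ta tx] : a != t /\ x' != t by split; apply: contraNneq tB => <-.
    pose p q := if q == b then [set x'; b] else [set t; b].
    have pb : p b = [set x'; b] by rewrite /p eqxx.
    have pc : p c = [set t; b] by rewrite /p eq_sym (negbTE bc').
    have BtE u : u \in t |: B -> u = t \/ [\/ u = a, u = x', u = b | u = c].
      rewrite BE in_setU1 !inE -!orbA => /orP[/eqP|/or4P]; first by left.
      by case=> /eqP->; right; constructor.
    apply: (@tight_not_pairs A L (t |: B) h [set b; c] p c) => //.
    * by apply/subsetP => u /set2P[]->; apply: setU1r.
    * by rewrite !inE eqxx orbT.
    * move=> v u /set2P[]-> /BtE[|[]]->; rewrite ?eqxx // => _.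
      - exact: Mtz.
      - by rewrite incomparable_sym.
      - by rewrite incomparable_sym.
      - exact: Mtz.
      - by rewrite incomparable_sym.
      - by rewrite incomparable_sym.
      - by rewrite incomparable_sym.
    * move=> v /set2P[]->; rewrite ?pb ?pc; split; rewrite ?cards2; try by case: (_ != _).
      - by rewrite subUset !sub1set !inE Bx Bb !orbT xc' bc'.
      - by exists b; rewrite !inE eqxx ?orbT.
      - by rewrite subUset !sub1set !inE eqxx Bb !orbT bc' eq_sym ct.
      - by exists b; rewrite !inE eqxx ?orbT.
    * have ap v : v \in [set b; c] -> a \notin p v.
        by case/set2P=> ->; rewrite ?pb ?pc !inE negb_or ?ta ab' ?(lt_eqF ax).
      have at' : (a < t)%O by rewrite (lt_trans ax) // -yE.
      move=> v q Zv /BtE[|[]]->; rewrite !inE ?eqxx ?orbT // => _;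
        by exists a; rewrite ?setU1r // ap // ?lexx // ltW.
    * move=> v v' /set2P[]-> /set2P[]->; rewrite ?eqxx // ?pb ?pc => _.
        by exists x'; rewrite !inE ?eqxx // negb_or tx.
      by exists t; rewrite !inE ?eqxx // negb_or ![t == _]eq_sym tx.
  + by case: (notM a Ba); rewrite ?yE 1?incomparable_sym // (negbTE aM).
  + by case: (notM a Ba); rewrite ?yE 1?incomparable_sym // (negbTE aM).
Qed.

End LastBlock.

(** * Posets that admit no reduction *)

Section LowerBounds.

Variables (d : Order.disp_t) (P : finPOrderType d).
Implicit Types (A B L : {set P}) (x y z t : P) (h : nat).

Definition rigid A : Prop :=
  forall (T : finType) (W : {set T}) (s : P -> {set T}), embeds A W s -> #|A| <= #|W|.

Lemma rigid_tight A h : rigid A -> tight A (fun=> h).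
Proof. by move=> rA T W s /rA. Qed.

Lemma tight_rigid A h : #|A| <= h -> tight A (fun=> h) -> rigid A.
Proof.
move=> Ah tA T W s sP; rewrite leqNgt; apply/negP => WA.
have := WA; rewrite ltnNge (tA _ _ _ sP) // => x Ax.
by apply: leq_trans (subset_leq_card (sP.1 _ Ax)) _; lia.
Qed.

(** The chain elements have distinct sizes, and incomparability with the centre excludes the sizes 0
    and [#|W|]. *)
Lemma star_rigid B : star B -> rigid B.
Proof.
case=> c [Bc [l Bl lc] cB chainB] T W s [sW sE].
rewrite (cardsD1 c) Bc add1n.
have inj : {in B :\ c &, injective (fun x => inord #|s x| : 'I_#|W|.+1)}.
  move=> x y /setD1P[xc Bx] /setD1P[yc By] /(congr1 val).
  rewrite /= !inordK ?ltnS ?subset_leq_card ?sW // => sxy.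
  have := chainB x y Bx By xc yc; rewrite /Order.comparable !sE //.
  have eq (u v : P) : u \in B -> v \in B -> #|s u| = #|s v| -> s u \subset s v -> u = v.
    move=> Bu Bv suv sub; have /eqP suvE : s u == s v by rewrite eqEcard sub suv /=.
    by apply/le_anti; rewrite !sE // suvE subxx.
  by case/orP=> [/eq|/eq/esym]; apply.
rewrite -(card_in_imset inj).
have sub : [set (inord #|s x| : 'I_#|W|.+1) | x in B :\ c] \subset
    [set: 'I_#|W|.+1] :\: [set ord0; ord_max].
  apply/subsetP => _ /imsetP[x /setD1P[xc Bx] ->].
  have := cB x Bx xc; rewrite incomparableE !sE // => /andP[xc' cx'].
  have szx : #|s x| < #|W|.+1 by rewrite ltnS subset_leq_card ?sW.
  rewrite !inE andbT negb_or -!val_eqE /= !inordK //; apply/andP; split.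
    by apply: contraNneq xc' => /eqP; rewrite cards_eq0 => /eqP->; apply: sub0set.
  apply: contraNneq cx' => sxW; have /eqP -> : s x == W.
    by rewrite eqEcard sW //= sxW.
  exact: sW.
have W_gt0 : 0 < #|W|.
  apply: contraTT isT => /=; rewrite -eqn0Ngt cards_eq0 => /eqP W0.
  have := cB l Bl lc; rewrite incomparableE !sE //.
  by have := sW l Bl; rewrite W0 subset0 => /eqP->; rewrite sub0set.
apply: leq_ltn_trans (subset_leq_card sub) _.
rewrite cardsD setTI cardsT card_ord cards2 -val_eqE /=.
by rewrite neq_ltn W_gt0 /=; lia.
Qed.

(** No set is empty, since there are at least two incomparable elements; so the sets are distinct
    singletons. *)
Lemma antichain_tight B : antichain B -> 1 < #|B| -> tight B (fun=> 1).
Proof.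
move=> anti B2 T W s [sW sE] s1.
have neq0 x : x \in B -> exists a, a \in s x.
  move=> Bx; apply/set0Pn/negP => /eqP sx0.
  have /card_gt1P[u [v [Bu Bv uv]]] := B2.
  have xE w : w \in B -> x = w by move=> Bw; apply: anti; rewrite // sE // sx0 sub0set.
  by move: uv; rewrite -(xE u) // -(xE v) // eqxx.
pose f x := [pick a in s x].
have fP x : x \in B -> exists2 a, f x = Some a & s x = [set a].
  move=> Bx; rewrite /f; case: pickP => [a ax|/(_ _) sx0]; last first.
    by have [a] := neq0 x Bx; rewrite sx0.
  exists a => //; apply/esym/eqP; rewrite eqEcard sub1set ax cards1.
  exact: s1.
have inj : {in B &, injective f}.
  move=> x y Bx By; have [a -> sx] := fP x Bx; have [a' -> sy] := fP y By.
  by case=> aa'; apply: anti; rewrite // sE // sx sy aa'.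
rewrite -(card_in_imset inj) -(card_imset W (f := Some)); last by move=> ? ? [].
apply/subset_leq_card/subsetP => _ /imsetP[x Bx ->]; have [a -> sx] := fP x Bx.
by apply: imset_f; have /subsetP := sW x Bx; apply; rewrite sx set11.
Qed.

(* A triangle if [a = e], otherwise K4 or K4 minus the edge [a e] in the
   incomparability graph. *)
Definition quad B := exists a b c e, B = [set a; b; c; e] /\
  [/\ (a >< b)%O, (a >< c)%O, (b >< c)%O, (b >< e)%O & (c >< e)%O].

Definition bits_le (u v : bool * bool * bool) : bool :=
  [&& u.1.1 ==> v.1.1, u.1.2 ==> v.1.2 & u.2 ==> v.2].

Definition bits_inc u v := ~~ bits_le u v && ~~ bits_le v u.

(** The codes [a], [b], [c] fill the level of singletons or the level of pairs of the three-bit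
    cube; either level uses the third bit. *)
Lemma four_bit_codes (a b c e : bool * bool * bool) :
    bits_inc a b -> bits_inc a c -> bits_inc b c -> bits_inc b e -> bits_inc c e ->
  a = e /\ a.2 || b.2 || c.2.
Proof.
case: a b => [[a1 a2] a3] [[b1 b2] b3]; case: a1 a2 a3 b1 b2 b3 => [] [] [] [] [] [] //=;
case: c => [[c1 c2] c3] _; case: c1 c2 c3 => [] [] [] //=;
by case: e => [[e1 e2] e3] _ _; case: e1 e2 e3 => [] [] [].
Qed.

Lemma card_set3 (a b c : P) : #|[set a; b; c]| <= 3.
Proof.
have [+ _] := leq_card_setU [set a; b] [set c]; rewrite cards1 cards2.
by case: (a != b) => /=; lia.
Qed.

Lemma quad_rigid B : quad B -> rigid B.
Proof.
case=> a [b [c [e [BE [ab ac bc be ce]]]]] T W s [sW sE].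
have [Ba Bb Bc Be] : [/\ a \in B, b \in B, c \in B & e \in B].
  by rewrite BE !inE !eqxx ?orbT.
have B4 : #|B| <= 4.
  rewrite BE; have [le _] := leq_card_setU [set a; b; c] [set e].
  by apply: leq_trans le _; rewrite cards1 addn1 ltnS card_set3.
have [|W3] := leqP 4 #|W|; first exact: leq_trans.
(* A missing token yields [None] and a bit that is false everywhere, so fewer than three tokens are
   handled in the same cube. At the end this false third bit excludes two tokens. *)
pose w i := nth None [seq Some u | u <- enum W] i.
pose bit i x := if w i is Some u then u \in s x else false.
pose code x := (bit 0 x, bit 1 x, bit 2 x).
have codeP x y : x \in B -> y \in B -> bits_le (code x) (code y) = (x <= y)%O.
  move=> Bx By; rewrite sE //; apply/idP/subsetP => [cxy u ux|sub]; last first.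
    rewrite /bits_le /code /=; apply/and3P; split;
    by rewrite /bit; case: (w _) => // u; apply/implyP/sub.
  have Wu : u \in enum W by rewrite mem_enum; have /subsetP := sW x Bx; apply.
  have iW : index u (enum W) < #|W| by rewrite cardE index_mem.
  have wu : w (index u (enum W)) = Some u.
    by rewrite /w (nth_map u) ?index_mem // nth_index.
  have bxy : bit (index u (enum W)) x ==> bit (index u (enum W)) y.
    have /and3P[b0 b1 b2] := cxy; move: b0 b1 b2; rewrite /code /=.
    move: (index _ _) iW => [|[|[|i]]] iW b0 b1 b2; [exact: b0|exact: b1|exact: b2|].
    by have := leq_trans iW W3; rewrite !ltnS ltn0.
  by move: bxy; rewrite /bit wu ux.
have incP x y : x \in B -> y \in B -> (x >< y)%O -> bits_inc (code x) (code y).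
  by move=> Bx By; rewrite incomparableE /bits_inc !codeP.
have [ae bits] := four_bit_codes (incP _ _ Ba Bb ab) (incP _ _ Ba Bc ac)
  (incP _ _ Bb Bc bc) (incP _ _ Bb Be be) (incP _ _ Bc Be ce).
have {}ae : a = e.
  by apply: le_anti; rewrite -!codeP // ae /bits_le !implybb.
have B3 : #|B| <= 3.
  rewrite BE -ae (_ : _ :|: [set a] = [set a; b; c]) ?card_set3 //.
  by apply/setP => u; rewrite !inE; case: (u == a); rewrite ?orbT ?orbF.
apply: leq_trans B3 _; rewrite ltnNge; apply/negP => W2.
by move: bits; rewrite /= /bit /w nth_default // size_map -cardE.
Qed.

(** A token separating elements of [L] lies in some set of [L], hence in every set of [B], and
    separates nothing in [B]. So the two kinds of separating tokens are disjoint. Each set of [B]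
    contains all those of [L], at least [#|L|] many, and has at most [k] of its own. *)
Lemma tight_sum A L B k :
  A = L :|: B -> below L B -> rigid L -> tight B (fun=> k) -> tight A (fun=> #|L| + k).
Proof.
move=> AE LB rL tB T W s [sW sE] sk.
pose split (C : {set P}) :=
  [set u in W | [exists x in C, u \in s x] && [exists y in C, u \notin s y]].
have emb (C : {set P}) : {subset C <= A} -> embeds C (split C) (fun x => s x :&: split C).
  move=> CA; split=> [x _|x y Cx Cy]; first exact: subsetIr.
  rewrite sE ?CA //; apply/idP/idP => [|/subsetP sub]; first exact: setSI.
  apply/subsetP => u ux; apply: contraT => uy.
  suff /sub : u \in s x :&: split C by rewrite inE (negbTE uy).
  rewrite !inE ux; have /subsetP-> //= := sW x (CA x Cx).
  by apply/andP; split; apply/exists_inP; [exists x|exists y].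
have LA : {subset L <= A} by move=> x; rewrite AE inE => ->.
have BA : {subset B <= A} by move=> x; rewrite AE inE orbC => ->.
have Ls := rL _ _ _ (emb L LA).
have below_s x y : x \in L -> y \in B -> s x \subset s y.
  by move=> Lx By; rewrite -(sE _ _ (LA _ Lx) (BA _ By)) ltW ?LB.
have Bs : #|B| <= #|split B|.
  apply: tB (emb B BA) _ => x Bx; rewrite -(leq_add2l #|split L|).
  have dis : split L :&: (s x :&: split B) = set0.
    apply/setP => u; rewrite in_set0; apply/negP => /setIP[+ /setIP[_]].
    rewrite !inE => /and3P[_ /exists_inP[l Ll ul] _] /and3P[_ _ /exists_inP[b Bb]].
    by rewrite (subsetP (below_s _ _ Ll Bb)).
  have <- : #|split L :|: (s x :&: split B)| = #|split L| + #|s x :&: split B|.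
    by rewrite cardsU dis cards0 subn0.
  apply: (@leq_trans #|s x|).
    apply/subset_leq_card; rewrite subUset subsetIl andbT; apply/subsetP => u.
    rewrite inE => /and3P[_ /exists_inP[l Ll ul] _].
    exact: (subsetP (below_s _ _ Ll Bx)).
  by apply: leq_trans (sk x (BA x Bx)) _; rewrite leq_add2r.
have dis : split L :&: split B = set0.
  apply/setP => u; rewrite in_set0; apply/negP => /setIP[].
  rewrite !inE => /and3P[_ /exists_inP[l Ll ul] _] /and3P[_ _ /exists_inP[b Bb]].
  by rewrite (subsetP (below_s _ _ Ll Bb)).
apply: leq_trans (leq_trans (leq_add Ls Bs) _).
  by rewrite AE leq_card_setU.
rewrite -[leqLHS]subn0 -(cards0 T) -dis -cardsU; apply/subset_leq_card.
by rewrite subUset; apply/andP; split; apply/subsetP => u; rewrite inE => /andP[].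
Qed.

Lemma rigid_sum A L B :
  A = L :|: B -> below L B -> rigid L -> rigid B -> rigid A.
Proof.
move=> AE LB rL rB; apply: (@tight_rigid A (#|L| + #|B|)).
  by rewrite AE leq_card_setU.
exact: tight_sum AE LB rL (rigid_tight rB).
Qed.

End LowerBounds.

(** * Local description of the components of the incomparability graph *)

Section LocalCriteria.

Variables (d : Order.disp_t) (P : finPOrderType d).
Implicit Types (A B C L : {set P}) (x y z t : P) (h : nat).

Definition inc A x y : bool := [&& x \in A, y \in A & (x >< y)%O].

Definition lts A x y : bool := [&& x \in A, y \in A & (x < y)%O].

(** The component of [c] is a star with centre [c]: it has a leaf, and leaves have no further
    neighbour. *)
Definition star_center A c : Prop :=
  (exists y, inc A c y) /\ forall y z, inc A c y -> inc A y z -> z = c.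

Definition in_star A x : Prop := exists c, (x = c \/ inc A c x) /\ star_center A c.

(** The last clause closes the four elements under incomparability. The binary nesting of the
    connectives matches that of [formula]. *)
Definition quad_block A a b c e : Prop :=
  (((inc A a b /\ inc A a c) /\ (inc A b c /\ inc A b e)) /\ inc A c e) /\
  forall q, ((inc A a q \/ inc A b q) \/ (inc A c q \/ inc A e q)) ->
    (q = a \/ q = b) \/ (q = c \/ q = e).

Definition in_quad A x : Prop :=
  exists a b c e, ((x = a \/ x = b) \/ (x = c \/ x = e)) /\ quad_block A a b c e.

(** An element that is neither [x] nor a neighbour of it is comparable to the maximal [x], hence
    below it and then below all neighbours. So [x] and its neighbours form an antichain lying above
    everything else. *)
Definition in_top_antichain A x : Prop :=
  ((exists y, inc A x y) /\ forall y, ~ lts A x y) /\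
  forall y, inc A x y -> (forall z, ~ lts A y z) /\ (forall z, lts A z x -> lts A z y).

Definition small_blocks A : Prop := forall x, x \in A -> in_star A x \/ in_quad A x.

Definition small_blocks_or_top A : Prop :=
  forall x, x \in A -> (in_star A x \/ in_quad A x) \/ in_top_antichain A x.

Lemma inc_sym A x y : inc A x y = inc A y x.
Proof. by rewrite /inc comparable_sym andbCA. Qed.

(** A union of components of the incomparability graph; the star and quad criteria can be checked
    inside it. *)
Definition inc_closed A C : Prop :=
  {subset C <= A} /\ forall x y, x \in C -> inc A x y -> y \in C.

Lemma inc_closedE A C x y : inc_closed A C -> x \in C -> inc A x y = inc C x y.
Proof.
move=> [CA cl] Cx; have := cl x y Cx; rewrite /inc Cx CA //= => yC.
apply/andP/andP => -[Ay xy]; split=> //; last exact: CA.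
by apply: yC; rewrite Ay.
Qed.

Lemma star_center_local A C c :
  inc_closed A C -> c \in C -> star_center A c <-> star_center C c.
Proof.
move=> clC Cc; have cE y : inc A c y = inc C c y by apply: inc_closedE.
have yE y z : inc C c y -> inc A y z = inc C y z.
  by case/and3P=> _ Cy _; apply: inc_closedE.
split=> -[[y cy] h]; split; try by exists y; rewrite ?cE // -cE.
- by move=> u v cu uv; apply: (h u); rewrite ?cE // yE.
- by move=> u v cu uv; rewrite cE in cu; apply: (h u); rewrite // -yE.
Qed.

Lemma in_star_local A C x : inc_closed A C -> x \in C -> in_star A x <-> in_star C x.
Proof.
move=> clC Cx; split=> -[c [xc cs]]; exists c.
  have Cc : c \in C.
    case: xc => [<-//|cx]; apply: clC.2 Cx _; rewrite inc_sym; exact: cx.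
  by rewrite -(inc_closedE _ clC Cc); split=> //; apply/(star_center_local clC Cc).
have Cc : c \in C by case: xc => [<-//|/and3P[]].
by rewrite (inc_closedE _ clC Cc); split=> //; apply/(star_center_local clC Cc).
Qed.

Lemma quad_block_local A C a b c e : inc_closed A C ->
    [/\ a \in C, b \in C, c \in C & e \in C] ->
  quad_block A a b c e <-> quad_block C a b c e.
Proof.
move=> clC [Ca Cb Cc Ce].
have aE y : inc A a y = inc C a y by apply: inc_closedE.
have bE y : inc A b y = inc C b y by apply: inc_closedE.
have cE y : inc A c y = inc C c y by apply: inc_closedE.
have eE y : inc A e y = inc C e y by apply: inc_closedE.
rewrite /quad_block !aE !bE !cE; split=> -[h1 h2]; split=> // q.
  by rewrite -aE -bE -cE -eE; apply: h2.
by rewrite aE bE cE eE; apply: h2.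
Qed.

Lemma quad_block_mem A a b c e :
  quad_block A a b c e -> [/\ a \in A, b \in A, c \in A & e \in A].
Proof. by case=> [[[[/and3P[-> -> _] _] _] /and3P[-> -> _]] _]. Qed.

Lemma in_quad_local A C x : inc_closed A C -> x \in C -> in_quad A x <-> in_quad C x.
Proof.
move=> clC Cx; split=> -[a [b [c [e [xabce q]]]]]; exists a, b, c, e; split=> //.
  apply/(quad_block_local clC) => //.
  case: q => [[[[ab ac] [bc be]] ce] _].
  have cl u v : inc A u v -> u \in C -> v \in C by move=> uv Cu; apply: clC.2 uv.
  have cl' u v : inc A u v -> v \in C -> u \in C by rewrite inc_sym; apply: cl.
  case: xabce => [[]|[]] xE; rewrite xE in Cx.
  - have Cb := cl _ _ ab Cx; have Cc := cl _ _ ac Cx.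
    by split=> //; apply: cl ce Cc.
  - have Ca := cl' _ _ ab Cx; have Cc := cl _ _ bc Cx.
    by split=> //; apply: cl ce Cc.
  - have Ca := cl' _ _ ac Cx; have Cb := cl' _ _ bc Cx.
    by split=> //; apply: cl ce Cx.
  - have Cb := cl' _ _ be Cx; have Cc := cl' _ _ ce Cx.
    by split=> //; apply: cl' ab Cb.
by apply/(quad_block_local clC) => //; apply: quad_block_mem q.
Qed.

Lemma below_closed A L B :
  A = L :|: B -> below L B -> inc_closed A L /\ inc_closed A B.
Proof.
move=> AE LB; split; split=> x; try by rewrite AE inE => ->; rewrite ?orbT.
  move=> y Lx /and3P[_ + xy]; rewrite AE inE => /orP[//|By].
  by move: xy; rewrite incomparableE (ltW (LB _ _ Lx By)).
move=> y Bx /and3P[_ + xy]; rewrite AE inE => /orP[Ly|//].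
by move: xy; rewrite incomparableE (ltW (LB _ _ Ly Bx)) andbF.
Qed.

Lemma star_small B : star B -> small_blocks B.
Proof.
case=> c [Bc [l Bl lc] cB chainB] x Bx; left; exists c; split.
  have [->|xc] := eqVneq x c; [by left|right].
  by rewrite /inc Bc Bx incomparable_sym cB.
split; first by exists l; rewrite /inc Bc Bl incomparable_sym cB.
move=> y z /and3P[_ By cy] /and3P[_ Bz yz]; apply/eqP; apply: contraNT yz => zc.
apply: chainB => //; apply: contraNneq cy => ->; exact: comparablexx.
Qed.

Lemma quad_small B : quad B -> small_blocks B.
Proof.
case=> a [b [c [e [BE [ab ac bc be ce]]]]] x Bx; right; exists a, b, c, e.
have BP q : q \in B -> (q = a \/ q = b) \/ (q = c \/ q = e).
  by rewrite BE !inE -!orbA => /or4P[]/eqP->; auto.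
have [Ba Bb Bc Be] : [/\ a \in B, b \in B, c \in B & e \in B].
  by rewrite BE !inE !eqxx ?orbT.
split; first exact: BP.
rewrite /quad_block /inc Ba Bb Bc Be ab ac bc be ce; split=> // q.
by case=> -[] /and3P[_ /BP].
Qed.

Lemma kite_quad B : kite B -> quad B.
Proof.
case=> a [x [b [c [-> [ax ab ac xb [xc bc]]]]]]; exists a, b, c, x; split.
  by apply/setP => u; rewrite !inE; do 4!case: (u == _).
by split=> //; rewrite incomparable_sym.
Qed.

Lemma antichain_inc B x y : antichain B -> x \in B -> y \in B -> x != y -> (x >< y)%O.
Proof.
move=> anti Bx By xy; rewrite incomparableE; apply/andP; split; apply: contraNN xy.
  by move/(anti _ _ Bx By)->.
by move/(anti _ _ By Bx)->.
Qed.

Lemma antichain_small B : antichain B -> 1 < #|B| <= 4 -> star B \/ quad B.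
Proof.
move=> anti; have incB := antichain_inc anti.
have := enum_uniq B; have memB x : (x \in B) = (x \in enum B) by rewrite mem_enum.
rewrite cardE; case E: (enum B) memB => [|a [|b [|c [|e [|]]]]] //= memB.
- rewrite inE andbT => ab _; left; exists a.
  have BE u : u \in B -> u = a \/ u = b.
    by rewrite memB !inE => /orP[]/eqP; auto.
  have [Ba Bb] : a \in B /\ b \in B by rewrite !memB !inE !eqxx orbT.
  split=> //; first by exists b; rewrite // eq_sym.
    by move=> u Bu ua; apply: incB.
  by move=> u v /BE[]-> /BE[]->; rewrite ?eqxx // comparablexx.
- rewrite !inE !negb_or -!andbA => /and4P[ab ac bc _] _; right; exists a, b, c, a.
  have [Ba Bb Bc] : [/\ a \in B, b \in B & c \in B].
    by rewrite !memB !inE !eqxx !orbT.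
  split; first by apply/setP => u; rewrite memB !inE; do 3!case: (u == _).
  by split; apply: incB; rewrite // eq_sym.
- rewrite !inE !negb_or -!andbA => /and5P[ab ac ae bc /and3P[be ce _]] _.
  have [Ba Bb Bc Be] : [/\ a \in B, b \in B, c \in B & e \in B].
    by rewrite !memB !inE !eqxx !orbT.
  right; exists a, b, c, e; split; last by split; apply: incB.
  by apply/setP => u; rewrite memB !inE !orbA.
Qed.

Lemma small_blocks_sum A L B : A = L :|: B -> below L B ->
  small_blocks L -> small_blocks B -> small_blocks A.
Proof.
move=> AE LB sL sB x; have [clL clB] := below_closed AE LB.
rewrite {1}AE inE => /orP[Lx|Bx].
  case: (sL x Lx) => [/(in_star_local clL Lx)|/(in_quad_local clL Lx)]; auto.
case: (sB x Bx) => [/(in_star_local clB Bx)|/(in_quad_local clB Bx)]; auto.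
Qed.

(* Five elements of an antichain can be coded by five of the six pairs of tokens
   from a set of four. *)
Lemma rigid_antichain A L B : A = L :|: B -> below L B -> rigid A ->
  antichain B -> #|B| <= 4.
Proof.
move=> AE LB rA anti; rewrite leqNgt; apply/negP => B5.
have incB := antichain_inc anti.
have dnA : {in A, forall z, #|dn A z| <= #|A|}.
  by move=> z _; apply/subset_leq_card/subsetP => u; rewrite inE => /andP[].
have Lh : #|L| + 2 <= #|A|.
  rewrite AE cardsU (_ : L :&: B = set0) ?cards0; first by lia.
  by apply/setP => u; rewrite !inE; apply/negP => /andP[Lu /(LB _ _ Lu)]; rewrite ltxx.
have := enum_uniq B; have memB x : (x \in B) = (x \in enum B) by rewrite mem_enum.
rewrite cardE in B5; case E: (enum B) memB B5 => [|a [|b [|c [|e [|f r]]]]] //= memB _.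
rewrite !inE !negb_or -!andbA.
case/and5P=> ab ac ae af /and5P[_ bc be bf /and5P[_ ce cf _ /and3P[ef _ _]]].
have [Ba Bb Bc Be] : [/\ a \in B, b \in B, c \in B & e \in B].
  by rewrite !memB !inE !eqxx !orbT.
have Bf : f \in B by rewrite memB !inE eqxx !orbT.
have pairwise := (ab, ac, ae, af, bc, be, bf, ce, cf, ef).
have pairwise' : [/\ b != a, c != a, e != a, f != a & c != b] /\
    [/\ e != b, f != b, e != c, f != c & f != e].
  by split; split; rewrite eq_sym.
case: pairwise' => -[ba ca ea fa cb] [eb fb ec fc fe].
pose Z := [set u in [:: a; b; c; e; f]].
pose p q := if q == a then [set a; b] else if q == b then [set a; c]
  else if q == c then [set a; e] else if q == e then [set b; c] else [set b; e].
have pa : p a = [set a; b] by rewrite /p eqxx.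
have pb : p b = [set a; c] by rewrite /p (negbTE ba) eqxx.
have pc : p c = [set a; e] by rewrite /p (negbTE ca) (negbTE cb) eqxx.
have pe : p e = [set b; c] by rewrite /p (negbTE ea) (negbTE eb) (negbTE ec) eqxx.
have pf : p f = [set b; e] by rewrite /p (negbTE fa) (negbTE fb) (negbTE fc) (negbTE fe).
have ZP u : u \in Z -> u = a \/ [\/ u = b, u = c, u = e | u = f].
  rewrite !inE => /orP[/eqP|/or4P]; first by left.
  by case=> /eqP->; right; constructor.
apply: (@tight_not_pairs _ _ A L B #|A| Z p f) => //.
- exact: rigid_tight.
- by apply/subsetP => u /ZP[|[]]->.
- by rewrite !inE eqxx !orbT.
- by move=> v u /ZP[|[]]-> Bu vu; apply: incB.
- by move=> v /ZP[|[]]->; rewrite ?pa ?pb ?pc ?pe ?pf; split;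
    rewrite ?subUset ?sub1set ?inE ?cards2 ?Ba ?Bb ?Bc ?Be ?pairwise //;
    try (by case: (_ != _));
    (exists a + exists b); rewrite !inE ?eqxx ?orbT.
- move=> v q Zv Bq Zq; exists q => //; rewrite lexx /=.
  move: Zq; rewrite !inE !negb_or => /and5P[qa qb qc qe qf].
  by case/ZP: Zv => [|[]]->; rewrite ?pa ?pb ?pc ?pe ?pf !inE negb_or ?qa ?qb ?qc ?qe.
- have out u v w : u != v -> u != w -> u \notin [set v; w].
    by move=> uv uw; rewrite !inE negb_or uv uw.
  move=> v v' /ZP[|[]]-> /ZP[|[]]->; rewrite ?eqxx ?pa ?pb ?pc ?pe ?pf // => _;
    solve [eexists; [exact: set21|exact: out]|eexists; [exact: set22|exact: out]].
Qed.

End LocalCriteria.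

(** * Removing the topmost component *)

Section BlockDecomposition.

Variables (d : Order.disp_t) (P : finPOrderType d).
Implicit Types (A B C L : {set P}) (x y z t : P) (h : nat).

(** An outsider [q] is comparable to [v], and [v <= q < u] would make [u] and [v] comparable. Along
    a component, an outsider therefore stays on one side. *)
Lemma below_propagate A B q u v : inc_closed A B -> q \in A -> q \notin B ->
  u \in B -> inc A u v -> (q < u)%O -> (q < v)%O.
Proof.
move=> [_ cl] Aq Bq Bu uv qu; have Bv := cl _ _ Bu uv.
case/and3P: uv => _ Av uv; rewrite incomparableE in uv; case/andP: uv => uv vu.
have : ~~ (q >< v)%O.
  by apply: contraNN Bq => qv; apply: cl Bv _; rewrite /inc Av Aq incomparable_sym.
rewrite negbK => /orP[|vq].
  by rewrite le_eqVlt => /orP[/eqP qv|//]; rewrite qv Bv in Bq.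
by rewrite (ltW (le_lt_trans vq qu)) in vu.
Qed.

Lemma maxima_below A B q t : inc_closed A B -> q \in A -> q \notin B ->
  t \in B -> t \in maxima A -> (q < t)%O.
Proof.
move=> [BA cl] Aq Bq Bt Mt.
have : ~~ (t >< q)%O.
  by apply: contraNN Bq => tq; apply: (cl t q Bt); rewrite /inc (BA _ Bt) Aq.
rewrite negbK /Order.comparable (maxima_le Mt Aq).
have qt : q != t by apply: contraNneq Bq => ->.
by rewrite (negbTE qt) le_eqVlt (negbTE qt).
Qed.

Lemma setD_split A B : {subset B <= A} -> A = (A :\: B) :|: B.
Proof.
move=> BA; apply/setP => x; rewrite !inE.
by case: (boolP (x \in B)) => [/BA->|]; rewrite ?orbF.
Qed.

(** Outsiders are comparable to the maximal [t], hence below it, and this spreads through the centre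
    to the whole component. *)
Lemma star_top A c t : star_center A c -> t = c \/ inc A c t -> t \in maxima A ->
  exists L B, [/\ A = L :|: B, below L B, t \in B & rigid B].
Proof.
move=> [[l cl] cP] tc Mt; pose B := c |: [set y | inc A c y].
have Ac : c \in A by case/and3P: cl.
have BP x : x \in B -> x = c \/ inc A c x.
  by case/setU1P=> [|]; [left|rewrite inE; right].
have Bc : c \in B by rewrite setU11.
have Bi x : inc A c x -> x \in B by move=> cx; rewrite setU1r // inE.
have clB : inc_closed A B.
  split=> [x /BP[->//|/and3P[]]//|x y /BP[->|cx] xy]; first exact: Bi.
  by rewrite (cP x y).
have Bt : t \in B by case: tc => [->//|/Bi].
exists (A :\: B), B; split=> //; first exact: setD_split clB.1.
  move=> q u /setDP[Aq Bq] Bu; have qt := maxima_below clB Aq Bq Bt Mt.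
  have prop := below_propagate clB Aq Bq.
  have qc : (q < c)%O.
    by case: tc => [<-//|ct]; apply: prop Bt _ qt; rewrite inc_sym.
  by case/BP: Bu => [->//|cu]; apply: prop Bc cu qc.
apply: star_rigid; exists c; split=> //.
- exists l; first exact: Bi.
  by case/and3P: cl => _ _ /incomparable_neq; rewrite eq_sym.
- move=> y /BP[->|/and3P[_ _ cy] _]; first by rewrite eqxx.
  by rewrite incomparable_sym.
- move=> y z /BP[->|cy]; first by rewrite eqxx.
  move=> /BP[->|cz _ zc]; first by rewrite eqxx.
  apply: contraT => yz; move: zc; rewrite (cP y z) ?eqxx //.
  by case/and3P: cy cz => _ Ay _ /and3P[_ Az _]; rewrite /inc Ay Az.
Qed.

Lemma quad_top A a b c e t : quad_block A a b c e ->
    (t = a \/ t = b) \/ (t = c \/ t = e) -> t \in maxima A ->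
  exists L B, [/\ A = L :|: B, below L B, t \in B & rigid B].
Proof.
move=> q tq Mt; pose B := [set a; b; c; e].
have [Aa Ab Ac Ae] := quad_block_mem q.
case: q => [[[[ab ac] [bc be]] ce] qP].
have BP x : x \in B -> (x = a \/ x = b) \/ (x = c \/ x = e).
  by rewrite !inE -!orbA => /or4P[]/eqP->; auto.
have BI x : (x = a \/ x = b) \/ (x = c \/ x = e) -> x \in B.
  by rewrite !inE => -[]-[]->; rewrite eqxx ?orbT.
have clB : inc_closed A B.
  split=> [x /BP[]-[]-> //|x y /BP xE xy]; apply/BI/qP.
  by case: xE xy => -[]->; auto.
have [Ba Bb Bc Be] : [/\ a \in B, b \in B, c \in B & e \in B] by split; apply: BI; auto.
have Bt := BI _ tq.
exists (A :\: B), B; split=> //; first exact: setD_split clB.1.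
  move=> q u /setDP[Aq Bq] Bu; have qt := maxima_below clB Aq Bq Bt Mt.
  have prop u' v : u' \in B -> inc A u' v -> (q < u')%O -> (q < v)%O.
    by move=> Bu' u'v; apply: below_propagate clB Aq Bq Bu' u'v.
  have prop' u' v : v \in B -> inc A u' v -> (q < v)%O -> (q < u')%O.
    by move=> Bv; rewrite inc_sym; apply: prop.
  have [qb qc] : (q < b)%O /\ (q < c)%O.
    case: tq => -[] tE; rewrite tE in qt; split=> //;
    by [apply: prop ab qt|apply: prop ac qt|apply: prop bc qt|apply: prop' bc qt
       |apply: prop' be qt|apply: prop' ce qt].
  by case/BP: Bu => -[]-> //; [apply: prop' ab qb|apply: prop be qb].
apply: quad_rigid; exists a, b, c, e; split=> //.
move: ab ac bc be ce => /and3P[_ _ ->] /and3P[_ _ ->] /and3P[_ _ ->].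
by move=> /and3P[_ _ ->] /and3P[_ _ ->].
Qed.

Lemma small_blocks_lower A L B :
  A = L :|: B -> below L B -> small_blocks A -> small_blocks L.
Proof.
move=> AE LB sA x Lx; have [clL _] := below_closed AE LB.
have Ax : x \in A by rewrite AE inE Lx.
by case: (sA x Ax) => [/(in_star_local clL Lx)|/(in_quad_local clL Lx)]; auto.
Qed.

(** Both directions strip a top block: rigidity yields one by [last_block], the local criterion
    yields the component of a maximal element. *)
Lemma rigidP A : rigid A <-> small_blocks A.
Proof.
have [n] := ubnP #|A|; elim: n A => // n IHn A /ltnSE An.
have IH L B : A = L :|: B -> below L B -> B != set0 -> rigid L <-> small_blocks L.
  move=> AE LB /set0Pn[b Bb]; apply: IHn; apply: leq_trans An; apply: proper_card.
  apply/properP; split; first by rewrite AE subsetUl.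
  exists b; first by rewrite AE inE Bb orbT.
  by apply/negP => /LB/(_ Bb); rewrite ltxx.
have [->|A0] := eqVneq A set0.
  by split=> [_ x|_ T W s _]; rewrite ?inE ?cards0.
have dnA : {in A, forall z, #|dn A z| <= #|A|}.
  by move=> z _; apply/subset_leq_card/subsetP => u; rewrite inE => /andP[].
split=> [rA|sA].
  have [L [B [AE LB B0 tL shape]]] := last_block A0 (rigid_tight rA) dnA.
  have sL : small_blocks L.
    by apply/(IH _ _ AE LB B0)/(tight_rigid (leqnn _) tL).
  apply: (small_blocks_sum AE LB sL).
  case: shape => [[anti B1]|[/star_small|/kite_quad/quad_small]] //.
  have := antichain_small anti; rewrite B1 (rigid_antichain AE LB rA anti).
  by case=> // [/star_small|/quad_small].
have [a Aa] := set0Pn _ A0; have [t Mt _] := maxima_above Aa.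
have At : t \in A by case/maximaP: Mt.
have [L [B [AE LB Bt rB]]] : exists L B, [/\ A = L :|: B, below L B, t \in B & rigid B].
  case: (sA t At) => [[c [tc cs]]|[b [c [e [f [tq q]]]]]]; first exact: star_top cs tc Mt.
  exact: quad_top q tq Mt.
have B0 : B != set0 by apply/set0Pn; exists t.
by apply: (rigid_sum AE LB _ rB); apply/(IH _ _ AE LB B0)/(small_blocks_lower AE LB).
Qed.

(** No down-set exceeds [#|L| + 1], which leaves one token for each element of [B]. *)
Lemma tight_antichain A L B : A = L :|: B -> below L B -> antichain B ->
    1 < #|B| -> rigid L ->
  tight A (fun=> \max_(x in A) #|dn A x|).
Proof.
move=> AE LB anti B1 rL T W s sP sh.
apply: (tight_sum AE LB rL (antichain_tight anti B1) sP) => x Ax.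
apply: leq_trans (sh x Ax) _; apply/bigmax_leqP => z Az.
rewrite card_dn // addn1 ltnS; apply/subset_leq_card/subsetP => u.
rewrite inE AE in_setU => /andP[/orP[//|Bu] uz].
move: Az; rewrite AE inE => /orP[/LB/(_ Bu)/lt_trans/(_ uz)|Bz]; first by rewrite ltxx.
by move: (uz); rewrite (anti _ _ Bu Bz (ltW uz)) ltxx.
Qed.

(** Only the top block feels the size bound; what lies under it is rigid, so [rigidP] settles it
    without a second induction. *)
Lemma tight_maxP A : A != set0 ->
  tight A (fun=> \max_(x in A) #|dn A x|) <-> small_blocks_or_top A.
Proof.
move=> A0; split=> [tA|sA].
  have dnA : {in A, forall z, #|dn A z| <= \max_(x in A) #|dn A x|}.
    by move=> z Az; apply: (leq_bigmax_cond (F := fun z => #|dn A z|)).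
  have [L [B [AE LB B0 tL shape]]] := last_block A0 tA dnA.
  have rL := tight_rigid (leqnn _) tL.
  have sL : small_blocks L by apply/rigidP.
  have small : small_blocks B -> small_blocks_or_top A.
    by move=> sB x Ax; left; apply: small_blocks_sum AE LB sL sB x Ax.
  case: shape => [[anti B1]|[/star_small|/kite_quad/quad_small]] // x Ax.
  have [clL clB] := below_closed AE LB.
  move: (Ax); rewrite {1}AE inE => /orP[Lx|Bx].
    by left; case: (sL x Lx) => [/(in_star_local clL Lx)|/(in_quad_local clL Lx)]; auto.
  have maxB y : y \in B -> forall z, ~ lts A y z.
    move=> By z /and3P[_ + yz]; rewrite AE inE => /orP[/LB/(_ By)/lt_trans/(_ yz)|Bz].
      by rewrite ltxx.
    by move: (yz); rewrite (anti _ _ By Bz (ltW yz)) ltxx.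
  right; split; first split; last 2 first.
  - exact: maxB.
  - move=> y xy; have By := clB.2 _ _ Bx xy.
    split=> [|z /and3P[Az _ zx]]; first exact: maxB.
    move: (Az); rewrite {1}AE inE => /orP[Lz|Bz]; last first.
      by move: (zx); rewrite (anti _ _ Bz Bx (ltW zx)) ltxx.
    by rewrite /lts Az LB // clB.1.
  have /card_gt1P[u [v [Bu Bv uv]]] := B1.
  have [xu|xu] := eqVneq x u.
    by exists v; rewrite /inc Ax clB.1 //= (antichain_inc anti) // xu.
  by exists u; rewrite /inc Ax clB.1 //= (antichain_inc anti).
have [a Aa] := set0Pn _ A0; have [t Mt _] := maxima_above Aa.
have At : t \in A by case/maximaP: Mt.
have lower L B : A = L :|: B -> below L B -> t \in B -> rigid L.
  move=> AE LB Bt; apply/rigidP => x Lx; have [clL _] := below_closed AE LB.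
  have Ax : x \in A by rewrite AE inE Lx.
  case: (sA x Ax) => [[/(in_star_local clL Lx)|/(in_quad_local clL Lx)]|]; auto.
  by case=> -[_ /(_ t)[]]; rewrite /lts Ax At LB.
have block : (exists L B, [/\ A = L :|: B, below L B, t \in B & rigid B]) ->
    tight A (fun=> \max_(x in A) #|dn A x|).
  case=> L [B [AE LB Bt rB]].
  exact/rigid_tight/(rigid_sum AE LB (lower L B AE LB Bt) rB).
case: (sA t At) => [[[c [tc cs]]|[b [c [e [f [tq q]]]]]]|].
- exact/block/(star_top cs tc Mt).
- exact/block/(quad_top q tq Mt).
case=> [[[y ty] maxt] tP]; pose B := t |: [set z | inc A t z].
have BP x : x \in B -> x = t \/ inc A t x.
  by case/setU1P=> [|]; [left|rewrite inE; right].
have Bt : t \in B by rewrite setU11.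
have BA : {subset B <= A} by move=> x /BP[->//|/and3P[]].
have maxB x : x \in B -> forall z, ~ lts A x z.
  by move=> /BP[->//|/tP[]].
have anti : antichain B.
  move=> u v Bu Bv; rewrite le_eqVlt => /orP[/eqP//|uv].
  by case: (maxB u Bu v); rewrite /lts !BA.
have AE := setD_split BA.
have LB : below (A :\: B) B.
  move=> q u /setDP[Aq Bq] Bu; have qt : lts A q t.
    have : ~~ (t >< q)%O.
      by apply: contraNN Bq => tq; rewrite setU1r // inE /inc At Aq.
    have qt : q != t by apply: contraNneq Bq => ->.
    rewrite negbK /Order.comparable (maxima_le Mt Aq) (negbTE qt) /=.
    by rewrite /lts Aq At lt_neqAle qt.
  by case/BP: Bu => [->|/tP[_ /(_ q qt)]]; [case/and3P: qt|case/and3P].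
apply: (tight_antichain AE LB anti _ (lower _ _ AE LB Bt)).
apply/card_gt1P; exists t, y; split=> //.
  by rewrite setU1r // inE.
by case/and3P: ty => _ _ /incomparable_neq.
Qed.

End BlockDecomposition.

(** * The three parameters *)

Section PosetParameters.

Variables (d : Order.disp_t) (P : finPOrderType d).
Implicit Types (S : P -> {fset nat}) (x y z : P) (h : P -> nat).

Lemma card_fset_sub (K : choiceType) (X Y : {fset K}) :
  (Y `<=` X)%fset -> #|[set a : X | val a \in Y]| = #|` Y|.
Proof.
move=> /fsubsetP YX; rewrite cardE -(size_map val); apply/perm_size/uniq_perm.
- by rewrite map_inj_uniq ?enum_uniq //; apply: val_inj.
- exact: fset_uniq.
move=> a; apply/mapP/idP => [[b + ->]|Ya]; first by rewrite mem_enum inE.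
by exists [` YX a Ya]%fset; rewrite // mem_enum inE.
Qed.

Lemma embeds_of_inclusion_rep S : inclusion_rep S ->
  exists (T : finType) (W : {set T}) (s : P -> {set T}),
    [/\ embeds [set: P] W s, #|W| = #|` ground S| & forall x, #|s x| = #|` S x|].
Proof.
move=> SP; exists (ground S), [set: ground S], (fun x => [set a | val a \in S x]).
split; last by move=> x; apply/card_fset_sub/sub_ground.
  split=> [x _|x y _ _]; first exact: subsetT.
  rewrite SP; apply/fsubsetP/subsetP => sub a.
    by rewrite !inE; apply: sub.
  move=> ax; have ga : a \in ground S by apply/mem_ground; exists x.
  by have := sub [` ga]%fset; rewrite !inE; apply.
by rewrite cardsT cardfE.
Qed.

Lemma inclusion_rep_of_embeds (T : finType) (W : {set T}) (s : P -> {set T}) :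
    embeds [set: P] W s ->
  exists S, [/\ inclusion_rep S, #|` ground S| <= #|W| & forall x, #|` S x| = #|s x|].
Proof.
case=> sW sE; pose S x := [fset (enum_rank a : nat) | a in s x]%fset.
have inj : injective (fun a : T => enum_rank a : nat).
  by move=> a b /ord_inj/enum_rank_inj.
have memS a x : ((enum_rank a : nat) \in S x) = (a \in s x).
  by apply/imfsetP/idP => [[b /= bx /inj->]|ax] //; exists a.
exists S; split.
- move=> x y; rewrite sE ?inE //; apply/subsetP/fsubsetP => sub a.
    by case/imfsetP => b /= /sub bx ->; rewrite memS.
  by rewrite -memS => /sub; rewrite memS.
- have sub : (ground S `<=` [fset (enum_rank a : nat) | a in W])%fset.
    apply/fsubsetP => a /mem_ground[x /imfsetP[b /= bx ->]].
    by apply: in_imfset; apply: (subsetP (sW x _)); rewrite ?inE.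
  apply: leq_trans (fsubset_leq_card sub) _.
  by rewrite card_imfset //= cardE.
- by move=> x; rewrite card_imfset //= cardE.
Qed.

Lemma tightTP h : tight [set: P] h <->
  forall S, inclusion_rep S -> (forall x, #|` S x| <= h x) -> #|P| <= #|` ground S|.
Proof.
split=> [tP S SP Sh|hS T W s sP sh].
  have [T [W [s [sP <- sS]]]] := embeds_of_inclusion_rep SP.
  by rewrite -cardsT; apply: tP sP _ => x _; rewrite sS.
have [S [SP SW Ss]] := inclusion_rep_of_embeds sP.
by rewrite cardsT; apply: leq_trans SW; apply: hS => // x; rewrite Ss sh ?inE.
Qed.

Lemma principal_rep : exists S, [/\ inclusion_rep S, #|` ground S| <= #|P| &
  forall x, #|` S x| = #|dn [set: P] x|].
Proof.
rewrite -cardsT; apply: (inclusion_rep_of_embeds (s := dn [set: P])).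
by split=> x; [rewrite subsetT|move=> y _ _; rewrite dn_sub ?inE].
Qed.

(* [Y] maximizes [#|Y| - #|N Y|], where [N Y] is the set of tokens having a
   minimal element in [Y]; the tokens outside [N Y] are traded for the principal
   up-sets of the elements outside [Y]. Maximality of [Y] is exactly what keeps
   the sets from growing. *)
Lemma reduce_or_dominate (T : finType) (W : {set T}) (s : P -> {set T}) :
    embeds [set: P] W s ->
  (exists (T' : finType) (W' : {set T'}) (s' : P -> {set T'}),
     [/\ embeds [set: P] W' s', #|W'| < #|P| & forall x, #|s' x| <= #|s x|]) \/
  (#|P| <= #|W| /\ forall x, #|dn [set: P] x| <= #|s x|).
Proof.
case=> sW sE; have {}sE x y : (x <= y)%O = (s x \subset s y) by rewrite sE ?inE.
pose at_min a x := (a \in s x) && [forall y, (y < x)%O ==> (a \notin s y)].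
pose N (Y : {set P}) := [set a in W | [exists x in Y, at_min a x]].
have NW Y : N Y \subset W by apply/subsetP => a; rewrite inE => /andP[].
have min_le a z : a \in s z -> exists2 x, (x <= z)%O & at_min a x.
  move=> az; pose Q x := (x <= z)%O && (a \in s x).
  have Qz : Q z by rewrite /Q lexx.
  case: (arg_minnP (fun x => #|dn [set: P] x|) Qz) => x /andP[xz ax] xmin.
  exists x; rewrite // /at_min ax; apply/forall_inP => y yx; apply/negP => ay.
  have := xmin y; rewrite /Q ay (ltW (lt_le_trans yx xz)) leqNgt => /(_ isT).
  rewrite proper_card //; apply/properP; split.
    by rewrite dn_sub ?inE // ltW.
  by exists x; rewrite !inE ?lexx // lt_geF.
have N_dn z : N (dn [set: P] z) = s z.
  apply/setP => a; rewrite inE; apply/andP/idP => [[_ /exists_inP[x]]|az].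
    by rewrite !inE /= sE => /subsetP xz /andP[/xz].
  split; first by apply: (subsetP (sW z _)); rewrite ?inE.
  have [x xz ax] := min_le a z az; apply/exists_inP; exists x => //.
  by rewrite !inE.
have NU Y Z : N (Y :|: Z) = N Y :|: N Z.
  apply/setP => a; rewrite !inE -andb_orr; congr andb.
  apply/exists_inP/orP => [[x /setUP[Yx|Zx] ax]|[]/exists_inP[x xY ax]].
  - by left; apply/exists_inP; exists x.
  - by right; apply/exists_inP; exists x.
  - by exists x; rewrite // inE xY.
  - by exists x; rewrite // inE xY orbT.
have [Y Ymax] : exists Y : {set P}, forall Z : {set P},
    #|Z| + #|W :\: N Z| <= #|Y| + #|W :\: N Y|.
  have [Y _ Ymax] := @arg_maxnP _ set0 predT (fun Y : {set P} => #|Y| + #|W :\: N Y|) isT.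
  by exists Y => Z; apply: Ymax.
have WN Z : #|W :\: N Z| + #|N Z| = #|W|.
  by rewrite cardsD (setIidPr (NW Z)) subnK ?subset_leq_card.
(* If even the maximum is not positive, Hall's inequality [#|Z| <= #|N Z|] holds for every [Z]; on
   principal down-sets it reads [#|dn z| <= #|s z|] by [N_dn]. *)
have [YN|NY] := ltnP #|N Y| #|Y|; last first.
  have YN (Z : {set P}) : #|Z| <= #|N Z|.
    by have := Ymax Z; have := WN Z; have := WN Y; lia.
  right; split=> [|x]; last by rewrite -N_dn.
  by rewrite -cardsT; apply: leq_trans (YN _) (subset_leq_card (NW _)).
left; exists (P + T)%type, (joint (~: Y) (N Y)).
exists (fun z => joint (dn [set: P] z :\: Y) (s z :&: N Y)); split.
- split=> [x _|x y _ _].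
    rewrite joint_sub subsetIr andbT; apply/subsetP => u.
    by rewrite !inE => /andP[].
  rewrite joint_sub; apply/idP/andP => [xy|[/subsetP sub1 /subsetP sub2]].
    by split; [rewrite setSD // dn_sub ?inE|rewrite setSI // -sE].
  rewrite sE; apply/subsetP => a ax.
  have [|aN] := boolP (a \in N Y).
    by move=> aN; have := sub2 a; rewrite in_setI ax aN => /(_ isT)/setIP[].
  (* A token traded away has a minimal element [u] outside [Y], whose principal token does its
     work. *)
  have [u ux ua] := min_le a x ax.
  have uY : u \notin Y.
    apply: contraNN aN => uY; rewrite inE; apply/andP; split.
      by apply: (subsetP (sW x _)); rewrite ?inE.
    by apply/exists_inP; exists u.
  have := sub1 u; rewrite !inE uY ux => /(_ isT)/= uy.
  by move: uy; rewrite sE => /subsetP; apply; case/andP: ua.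
- by rewrite card_joint addnC -(cardsC Y) ltn_add2r.
have cardU (V : finType) (A B : {set V}) : #|A :|: B| = #|A| + #|B :\: A|.
  by rewrite -(cardsID A (A :|: B)) (setIidPr (subsetUl _ _)) setDUl setDv set0U.
move=> z; rewrite card_joint -(cardsID (N Y) (s z)) addnC leq_add2l.
(* Enlarging [Y] by the down-set of [z] gains nothing, so the principal tokens added to [z] are at
   most as many as the tokens removed from it. *)
have := Ymax (Y :|: dn [set: P] z); rewrite cardU -addnA leq_add2l => YN'.
rewrite -(leq_add2r #|W :\: N (Y :|: dn [set: P] z)|); apply: leq_trans YN' _.
have := WN (Y :|: dn [set: P] z); have := WN Y.
by rewrite NU N_dn cardU; lia.
Qed.

Lemma rep_reduce_or_dominate S : inclusion_rep S ->
  (exists S', [/\ inclusion_rep S', #|` ground S'| < #|P| &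
     forall x, #|` S' x| <= #|` S x|]) \/
  (#|P| <= #|` ground S| /\ forall x, #|dn [set: P] x| <= #|` S x|).
Proof.
move=> SP; have [T [W [s [sP <- sS]]]] := embeds_of_inclusion_rep SP.
have [[T' [W' [s' [sP' W'P s's]]]]|[PW dns]] := reduce_or_dominate sP.
  have [S' [S'P gS' S's]] := inclusion_rep_of_embeds sP'.
  left; exists S'; split=> //; first exact: leq_ltn_trans gS' W'P.
  by move=> x; rewrite S's -sS.
by right; split=> // x; rewrite -sS.
Qed.

Lemma dim2_eq_card : dim2 P = #|P| <-> rigid [set: P].
Proof.
have [[S [SP Sdim]] dim_min] := least_natP (ground_size_exists P).
split=> [dimP T W s sP|rP].
  have [S' [S'P S'W _]] := inclusion_rep_of_embeds sP.
  rewrite cardsT -dimP; apply: leq_trans S'W; apply: dim_min; by exists S'.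
have [S0 [S0P S0n _]] := principal_rep.
apply/eqP; rewrite eqn_leq; apply/andP; split.
  by apply: leq_trans S0n; apply: dim_min; exists S0.
rewrite /dim2 -Sdim; have [T [W [s [sP <- _]]]] := embeds_of_inclusion_rep SP.
by rewrite -cardsT; apply: rP sP.
Qed.

(** The cube height need not be known beforehand. The exchange, applied to a representation of least
    height, either saves a token without raising the height, and both sides fail, or shows that
    [ch P] is the size of the largest principal down-set. *)
Lemma cw_eq_card : cw P = #|P| <->
  tight [set: P] (fun=> \max_(x in [set: P]) #|dn [set: P] x|).
Proof.
have [[Sh [ShP Shch]] ch_min] := least_natP (height_exists P).
have [[S [SP Scw Sch]] cw_min] := least_natP (ch_rep_exists P).
rewrite -/(ch P) in ch_min Shch; rewrite -/(cw P) in cw_min Scw.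
set h := \max_(x in _) _.
have dnh x : #|dn [set: P] x| <= h.
  by apply: (leq_bigmax_cond (F := fun z => #|dn [set: P] z|)); rewrite inE.
have [S0 [S0P S0n S0dn]] := principal_rep.
have ch_le : ch P <= h by apply: ch_min; exists S0; split=> // x; rewrite S0dn.
have [[S' [S'P S'n S'S]]|[_ dnS]] := rep_reduce_or_dominate ShP.
  have S'ch x : #|` S' x| <= ch P by apply: leq_trans (S'S x) _.
  have cw_lt : cw P < #|P|.
    by apply: leq_ltn_trans S'n; apply: cw_min; exists S'; split.
  split=> [cwP|/tightTP tP]; first by rewrite cwP ltnn in cw_lt.
  have := tP S' S'P; rewrite leqNgt S'n => tS'; suff: false by [].
  by apply: tS' => x; apply: leq_trans (S'ch x) ch_le.
have chE : ch P = h.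
  apply/eqP; rewrite eqn_leq ch_le /=; apply/bigmax_leqP => x _.
  exact: leq_trans (dnS x) (Shch x).
rewrite -chE; split=> [cwP|/tightTP tP].
  apply/tightTP => S1 S1P S1h; rewrite -cwP; apply: cw_min; by exists S1; split.
apply/eqP; rewrite eqn_leq; apply/andP; split; last by rewrite -Scw tP.
apply: leq_trans S0n; apply: cw_min; exists S0; split=> // x.
by rewrite S0dn chE.
Qed.

(** An irreducible representation with [#|P|] tokens dominates the principal one, so a smaller
    family within the principal sizes would strictly reduce it. Conversely, tightness makes the
    principal representation irreducible, and larger ones always have a strict reduction. *)
Lemma iir_eq_card : iir P = #|P| <-> tight [set: P] (fun x => #|dn [set: P] x|).
Proof.
have [[S [[SP Sirr] Siir]] iir_max] :=
  greatest_natP (@irreducible_exists d P) (@irreducible_bounded d P).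
rewrite -/(iir P) in iir_max Siir.
have [S0 [S0P S0n S0dn]] := principal_rep.
split=> [iirP|/tightTP tP].
  apply/tightTP => S1 S1P S1dn; rewrite leqNgt; apply/negP => S1n.
  have [[S' [S'P S'n S'S]]|[_ dnS]] := rep_reduce_or_dominate SP; apply: Sirr.
    exists S'; split=> //; split; first by split=> //; rewrite Siir iirP ltnW.
    by case=> _ [+ _]; rewrite Siir iirP leqNgt S'n.
  exists S1; split=> //; split; first split.
  - by rewrite Siir iirP ltnW.
  - by move=> x; apply: leq_trans (S1dn x) (dnS x).
  by case=> _ [+ _]; rewrite Siir iirP leqNgt S1n.
apply/eqP; rewrite eqn_leq; apply/andP; split.
  rewrite leqNgt; apply/negP; rewrite -Siir => Sn; apply: Sirr.
  have [[S' [S'P S'n S'S]]|[_ dnS]] := rep_reduce_or_dominate SP.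
    exists S'; split=> //; split; first by split=> //; apply: ltnW (ltn_trans S'n Sn).
    by case=> _ [+ _]; rewrite leqNgt (ltn_trans S'n Sn).
  exists S0; split=> //; split; first split.
  - exact: leq_trans S0n (ltnW Sn).
  - by move=> x; rewrite S0dn.
  by case=> _ [+ _]; rewrite leqNgt (leq_ltn_trans S0n Sn).
have S0E : #|` ground S0| = #|P|.
  by apply/eqP; rewrite eqn_leq S0n tP // => x; rewrite S0dn.
rewrite -[X in X <= _]S0E; apply: iir_max; exists S0; split=> //; split=> //.
case=> S' [S'P [red neq]]; apply: neq; split=> //.
have S'dn x : #|` S' x| <= #|dn [set: P] x| by rewrite -S0dn; apply: red.2.
have nS' := tP S' S'P S'dn.
split; first by rewrite S0E.
have [[S1 [S1P S1n S1S]]|[_ dnS] x] := rep_reduce_or_dominate S'P; last by rewrite S0dn.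
have := tP S1 S1P; rewrite leqNgt S1n => tS1; suff: false by [].
by apply: tS1 => x; apply: leq_trans (S1S x) (S'dn x).
Qed.

End PosetParameters.

(** * The criterion for iir *)

Section IirCriterion.

Variables (d : Order.disp_t) (P : finPOrderType d).
Implicit Types (x y z u w : P).

(** Such a [w] witnesses that [x] is not the join of the elements strictly below it. *)
Definition escapes x w : Prop := ~ (x <= w)%O /\ forall u, (u < x)%O -> (u <= w)%O.

Definition unmergeable : Prop :=
  (forall x, exists w, escapes x w) /\
  forall x z, x = z \/
    exists w, (escapes x w /\ (z <= w)%O) \/ (escapes z w /\ (x <= w)%O).

(** For the converse, call a token of [x] new if no smaller element has it. An escape gives every
    [x] a new token, the size bound allows only one, and the second clause forbids two elements to
    share theirs; this injects [P] into [W]. *)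
Lemma tight_dnP : tight [set: P] (fun x => #|dn [set: P] x|) <-> unmergeable.
Proof.
split=> [tP|[esc sep]].
  have dnT : {in [set: P], forall z, #|dn [set: P] z| <= #|dn [set: P] z|} by [].
  split=> [x|x z].
    have [w [_ xw wP]] := tight_not_join tP dnT (in_setT x).
    by exists w; split=> [|u]; [apply/negP|apply: wP].
  have [->|xz] := eqVneq x z; [by left|right].
  have [w [_ H]] := tight_not_merge tP dnT (in_setT x) (in_setT z) xz.
  by exists w; case: H => -[/negP nw w' wP]; [left|right];
    do 2?split=> //; move=> u; apply: wP.
move=> T W s [sW sE] sdn.
have {}sE x y : (x <= y)%O = (s x \subset s y) by rewrite sE ?inE.
pose new x := s x :\: \bigcup_(y | (y < x)%O) s y.
have newP x a : a \in new x -> a \in s x /\ forall y, (y < x)%O -> a \notin s y.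
  case/setDP=> ax na; split=> // y yx; apply: contraNN na => ay.
  by apply/bigcupP; exists y.
have esc_new x w : escapes x w -> exists2 a, a \in new x & a \notin s w.
  case=> /negP; rewrite sE => /subsetPn[a ax aw] xw; exists a => //.
  rewrite inE ax andbT; apply: contraNN aw => /bigcupP[y yx ay].
  by have := xw y yx; rewrite sE => /subsetP; apply.
have new_ex x : exists a, a \in new x.
  by have [w /esc_new[a ax _]] := esc x; exists a.
pose f x := xchoose (new_ex x).
have fnew x : f x \in new x := xchooseP (new_ex x).
have f_neq x z : new x = [set f x] -> new z = [set f z] -> x != z -> f x != f z.
  move=> newx newz xz; apply/eqP => fxz.
  have key u v w : new u = [set f u] -> f u = f v -> escapes u w -> (v <= w)%O -> False.
    move=> newu fuv /esc_new[a]; rewrite newu => /set1P-> fuw.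
    rewrite sE => /subsetP/(_ (f v)).
    have [fv _] := newP _ _ (fnew v).
    by move=> /(_ fv) fvw; rewrite fuv fvw in fuw.
  case: (sep x z) => [/eqP|[w [[xw zw]|[zw xw]]]]; first by rewrite (negbTE xz).
    exact: key newx fxz xw zw.
  exact: key newz (esym fxz) zw xw.
(* By induction the smaller elements contribute [#|dlt x|] distinct tokens to [s x], whose size is
   at most one more. *)
have new1 x : new x = [set f x].
  have [n] := ubnP #|dlt [set: P] x|; elim: n x => // n IHn x /ltnSE xn.
  have IH y : (y < x)%O -> new y = [set f y].
    move=> yx; apply: IHn; apply: leq_trans xn; apply: proper_card.
    apply/properP; split; last by exists y; rewrite !inE ?yx ?ltxx.
    by apply/subsetP => u; rewrite !inE => /lt_trans; apply.
  have inj : {in dlt [set: P] x &, injective f}.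
    move=> y z; rewrite !inE /= => yx zx fyz; apply/eqP; apply: contraT.
    by move=> /(f_neq _ _ (IH y yx) (IH z zx)); rewrite fyz eqxx.
  have dis : f @: dlt [set: P] x :&: new x = set0.
    apply/setP => a; rewrite in_set0; apply/negP => /setIP[/imsetP[y]].
    rewrite inE => /andP[_ yx] -> /newP[_ /(_ y yx)].
    by have [-> _] := newP _ _ (fnew y).
  apply/esym/eqP; rewrite eqEcard sub1set fnew cards1.
  rewrite -(leq_add2l #|dlt [set: P] x|) -{1}(card_in_imset inj).
  have -> : #|f @: dlt [set: P] x| + #|new x| = #|f @: dlt [set: P] x :|: new x|.
    by rewrite cardsU dis cards0 subn0.
  rewrite addn1 -card_dn ?inE //; apply: leq_trans (sdn x _); rewrite ?inE //.
  apply/subset_leq_card; rewrite subUset subsetDl andbT.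
  apply/subsetP => a /imsetP[y]; rewrite !inE /= => yx ->.
  have [fy _] := newP _ _ (fnew y).
  by have := ltW yx; rewrite sE => /subsetP; apply.
have f_inj : injective f.
  move=> x z fxz; apply/eqP; apply: contraT => xz.
  by have := f_neq x z (new1 x) (new1 z) xz; rewrite fxz eqxx.
rewrite -(card_imset _ f_inj); apply/subset_leq_card/subsetP => _ /imsetP[x _ ->].
have [fx _] := newP _ _ (fnew x).
by apply: (subsetP (sW x _)); rewrite ?inE.
Qed.

End IirCriterion.

(** * The criteria as first-order sentences *)

Definition FOr f g := FNot (FAnd (FNot f) (FNot g)).
Definition FImp f g := FNot (FAnd f (FNot g)).
Definition FEx f := FNot (FAll (FNot f)).
Definition FLt i j := FAnd (FLe i j) (FNot (FLe j i)).
Definition FEq i j := FAnd (FLe i j) (FLe j i).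
Definition FInc i j := FAnd (FNot (FLe i j)) (FNot (FLe j i)).

Section SatReflection.

Variables (d : Order.disp_t) (P : finPOrderType d).
Implicit Types (env : nat -> P) (f g : formula) (v i j : nat) (A B : Prop).

Local Notation sat := (sat (<=%O : rel P)).

Lemma satNot v f env A : reflect A (sat v f env) -> reflect (~ A) (sat v (FNot f) env).
Proof. by move=> h; apply: (iffP negP) => hA /h. Qed.

Lemma satAnd v f g env A B : reflect A (sat v f env) -> reflect B (sat v g env) ->
  reflect (A /\ B) (sat v (FAnd f g) env).
Proof. by move=> hf hg; apply: (iffP andP) => -[/hf ? /hg]. Qed.

Lemma satOr v f g env A B : reflect A (sat v f env) -> reflect B (sat v g env) ->
  reflect (A \/ B) (sat v (FOr f g) env).
Proof.
move=> hf hg; rewrite /= negb_and !negbK.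
by apply: (iffP orP) => -[/hf|/hg]; auto.
Qed.

Lemma satImp v f g env A B : reflect A (sat v f env) -> reflect B (sat v g env) ->
  reflect (A -> B) (sat v (FImp f g) env).
Proof.
move=> hf hg; rewrite /= negb_and negbK -implybE.
by apply: (iffP implyP) => h /hf/h/hg.
Qed.

Lemma satAll v f env (Q : P -> Prop) :
  (forall x, reflect (Q x) (sat v.+1 f (extend env v x))) ->
  reflect (forall x, Q x) (sat v (FAll f) env).
Proof. by move=> h; apply: (iffP forallP) => hQ x; apply/h. Qed.

Lemma satEx v f env (Q : P -> Prop) :
  (forall x, reflect (Q x) (sat v.+1 f (extend env v x))) ->
  reflect (exists x, Q x) (sat v (FEx f) env).
Proof.
move=> h; rewrite /= negb_forall.
by apply: (iffP existsP) => -[x hx]; exists x; move: hx; rewrite negbK => /h.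
Qed.

Lemma satLe v i j env : reflect (env i <= env j)%O (sat v (FLe i j) env).
Proof. exact: idP. Qed.

Lemma satLt v i j env : reflect (env i < env j)%O (sat v (FLt i j) env).
Proof. by rewrite /= -lt_leAnge; apply: idP. Qed.

Lemma satEq v i j env : reflect (env i = env j) (sat v (FEq i j) env).
Proof. by rewrite /= -eq_le; apply: eqP. Qed.

Lemma satInc v i j env : reflect (inc [set: P] (env i) (env j)) (sat v (FInc i j) env).
Proof. by rewrite /inc !inE /= incomparableE; apply: idP. Qed.

Lemma satLts v i j env : reflect (lts [set: P] (env i) (env j)) (sat v (FLt i j) env).
Proof. by rewrite /lts !inE /=; apply: satLt. Qed.

Lemma satTrue v i env : reflect (env i \in [set: P]) (sat v (FLe i i) env).
Proof. by rewrite /= lexx inE; constructor. Qed.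

End SatReflection.

Definition star_formula : formula :=
  FEx (FAnd (FOr (FEq 0 1) (FInc 1 0))
    (FAnd (FEx (FInc 1 2)) (FAll (FAll (FImp (FInc 1 2) (FImp (FInc 2 3) (FEq 3 1))))))).

Definition quad_formula : formula :=
  FEx (FEx (FEx (FEx
    (FAnd (FOr (FOr (FEq 0 1) (FEq 0 2)) (FOr (FEq 0 3) (FEq 0 4)))
    (FAnd
      (FAnd (FAnd (FAnd (FInc 1 2) (FInc 1 3)) (FAnd (FInc 2 3) (FInc 2 4))) (FInc 3 4))
      (FAll (FImp (FOr (FOr (FInc 1 5) (FInc 2 5)) (FOr (FInc 3 5) (FInc 4 5)))
             (FOr (FOr (FEq 5 1) (FEq 5 2)) (FOr (FEq 5 3) (FEq 5 4)))))))))).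

Definition top_formula : formula :=
  FAnd (FAnd (FEx (FInc 0 1)) (FAll (FNot (FLt 0 1))))
    (FAll (FImp (FInc 0 1)
       (FAnd (FAll (FNot (FLt 1 2))) (FAll (FImp (FLt 2 0) (FLt 2 1)))))).

(** [FLe 0 0], true by reflexivity, stands for membership in the whole poset. *)
Definition dim2_formula : formula :=
  FAll (FImp (FLe 0 0) (FOr star_formula quad_formula)).

Definition cw_formula : formula :=
  FAll (FImp (FLe 0 0) (FOr (FOr star_formula quad_formula) top_formula)).

(** [k] is the level of the quantifier inside, so it must equal the number of variables bound so
    far. *)
Definition escapes_formula (i j k : nat) : formula :=
  FAnd (FNot (FLe i j)) (FAll (FImp (FLt k i) (FLe k j))).

Definition iir_formula : formula :=
  FAnd (FAll (FEx (escapes_formula 0 1 2)))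
    (FAll (FAll (FOr (FEq 0 1) (FEx
      (FOr (FAnd (escapes_formula 0 2 3) (FLe 1 2))
          (FAnd (escapes_formula 1 2 3) (FLe 0 2))))))).

Ltac reflect_sat := repeat first
  [ apply: satAll => ? | apply: satEx => ? | apply: satNot | apply: satImp | apply: satOr
  | apply: satInc | apply: satLts | apply: satLt | apply: satEq
  | apply: satAnd | apply: satTrue | apply: satLe ].

Section Formulas.

Variables (d : Order.disp_t) (P : finPOrderType d).
Implicit Type env : nat -> P.

Local Notation sat := (sat (<=%O : rel P)).

Lemma star_formulaP env : reflect (in_star [set: P] (env 0)) (sat 1 star_formula env).
Proof. by rewrite /in_star /star_center; reflect_sat. Qed.

Lemma quad_formulaP env : reflect (in_quad [set: P] (env 0)) (sat 1 quad_formula env).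
Proof. by rewrite /in_quad /quad_block; reflect_sat. Qed.

Lemma top_formulaP env :
  reflect (in_top_antichain [set: P] (env 0)) (sat 1 top_formula env).
Proof. by rewrite /in_top_antichain; reflect_sat. Qed.

Lemma dim2_formulaP env : reflect (small_blocks [set: P]) (sat 0 dim2_formula env).
Proof.
apply: satAll => x; apply: satImp; first exact: satTrue.
by apply: satOr; [apply: star_formulaP|apply: quad_formulaP].
Qed.

Lemma cw_formulaP env : reflect (small_blocks_or_top [set: P]) (sat 0 cw_formula env).
Proof.
apply: satAll => x; apply: satImp; first exact: satTrue.
apply: satOr; last exact: top_formulaP.
by apply: satOr; [apply: star_formulaP|apply: quad_formulaP].
Qed.

Lemma iir_formulaP env : reflect (unmergeable P) (sat 0 iir_formula env).
Proof. by rewrite /unmergeable /escapes; reflect_sat. Qed.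

End Formulas.

Theorem theorem1p5 :
  [/\ polytime_decidable (fun d (P : finPOrderType d) => dim2 P == #|P|),
      polytime_decidable (fun d (P : finPOrderType d) => cw P == #|P|)
    & polytime_decidable (fun d (P : finPOrderType d) => iir P == #|P|)].
Proof.
split.
- apply: (@polytime_first_order _ dim2_formula) => // d P env.
  by apply/eqP/dim2_formulaP; rewrite dim2_eq_card rigidP.
- apply: (@polytime_first_order _ cw_formula) => // d P env.
  (* An environment exists only over a non-empty poset. *)
  have P0 : [set: P] != set0 by apply/set0Pn; exists (env 0); rewrite inE.
  by apply/eqP/cw_formulaP; rewrite cw_eq_card tight_maxP.
- apply: (@polytime_first_order _ iir_formula) => // d P env.
  by apply/eqP/iir_formulaP; rewrite iir_eq_card tight_dnP.
Qed.
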